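(* Let $\mathcal L=\{Y_n\}=\{(X_n,J_n)\}$ be a $d$-dimensional skip-free semi-irreducible MMRRW with irreducible class $\mathcal S_0$, each of whose induced Markov chains $\mathcal L^A$ ($\emptyset\ne A\subset D$) is either semi-irreducible and stable, or transient. Then $\mathcal L$ is unstable if there exists a real function $f$ of the form $f(x)=\max_{1\le k\le m}f_k(x)$, $f_k(x)=\langle x,w_k\rangle$, $x\in\mathbb R^d$ (with $m$ a positive integer and $w_1,\dots,w_m\in\mathbb R^d$), such that, for some $c>0$, $\mathcal A_f\ne\emptyset$ and $\mathcal A_f^C\cap\mathcal S_0\ne\emptyset$, and furthermore, for every $A\in\mathcal D_{f,stable}$ and for every $k\in\mathcal I_{f,A}$, $f_k(a^A)>0$, where $a^A$ is the mean drift vector of the expanded Markov chain $\hat{\mathcal L}^A$.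
   Context: Notation: $D=\{1,\dots,d\}$; $\mathcal P(A)$ is the set of all subsets of $A$ (including $\emptyset$); for $x\in\mathbb R^d$, $x(l)$ is the $l$-th coordinate and $x(A)=(x(l))_{l\in A}$; relations between a vector and a number, such as $x(A)>0$, hold coordinatewise (vacuously if $A=\emptyset$); $\langle\cdot,\cdot\rangle$ is the Euclidean inner product. For $A\in\mathcal P(D)$ let $\mathcal B^A=\{x\in\mathbb R_+^d: x(A)>0,\ x(D\setminus A)=0\}$ and let $S^A=\{1,\dots,s^A\}$ be a finite set. MMRRW. A $d$-dimensional skip-free Markov modulated reflecting random walk (MMRRW) $\mathcal L=\{Y_n\}=\{(X_n,J_n)\}$ is a discrete-time homogeneous Markov chain on $\mathcal S=\bigcup_{A\in\mathcal P(D)}(\mathcal B^A\cap\mathbb Z^d)\times S^A$ such that $X_{n+1}-X_n\in\{-1,0,1\}^d$ and, whenever $x\in\mathcal B^A\cap\mathbb Z^d$, $z\in\{-1,0,1\}^d$, $x+z\in\mathcal B^B\cap\mathbb Z^d$, $i\in S^A$, $j\in S^B$, the probability $\mathbb P(Y_{n+1}=(x+z,j)\mid Y_n=(x,i))=p_z^{A,B}(i,j)$ depends only on $A,B,z,i,j$. Semi-irreducibility and stability (for any countable-state Markov chain). The chain is semi-irreducible if it has exactly one irreducible (closed communicating) class $\mathcal S_0$ and every state of $\mathcal S_0$ is accessible from every state. A semi-irreducible chain is stable if $\mathcal S_0$ is positive recurrent and from every state outside $\mathcal S_0$ the first passage time to $\mathcal S_0$ is a.s. finite with finite expectation. It is unstable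 if either $\mathcal S_0$ is transient, or there is a state outside $\mathcal S_0$ from which, with positive probability, $\mathcal S_0$ is never reached. Expanded and induced chains. Let $\emptyset\ne A\in\mathcal P(D)$. For $B\in\mathcal P(D\setminus A)$ let $\hat{\mathcal B}^{A,B}=\{x\in\mathbb R^d: x(B)>0,\ x(D\setminus(A\cup B))=0\}$ ($x(A)$ arbitrary). The expanded chain $\hat{\mathcal L}^A=\{Y^A_n\}=\{(X^A_n,J^A_n)\}$ is the Markov chain on $\hat{\mathcal S}^A=\bigcup_{B\in\mathcal P(D\setminus A)}(\hat{\mathcal B}^{A,B}\cap\mathbb Z^d)\times S^{A\cup B}$ with $\mathbb P(Y^A_{n+1}=(x+z,j)\mid Y^A_n=(x,i))=p_z^{A\cup B,A\cup C}(i,j)$ for $x\in\hat{\mathcal B}^{A,B}\cap\mathbb Z^d$, $z\in\{-1,0,1\}^d$, $x+z\in\hat{\mathcal B}^{A,C}\cap\mathbb Z^d$, $i\in S^{A\cup B}$, $j\in S^{A\cup C}$. The process $\mathcal L^A=\{(X^A_n(D\setminus A),J^A_n)\}$ is itself a Markov chain (a $(d-|A|)$-dimensional MMRRW; a finite chain if $A=D$), called the induced Markov chain with index $A$. ''$\mathcal L^A$ is transient'' means that all its states are transient (semi-irreducibility not required). $\mathcal D_{stable}$ is the set of nonempty $A\in\mathcal P(D)$ such that $\mathcal L^A$ is semi-irreducible and stable (always $D\in\mathcal D_{stable}$). For $A\in\mathcal D_{stable}$ the mean drift vector is $a^A=\lim_{n\to\infty}\frac1n(X^A_n-X^A_0)\in\mathbb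 R^d$ (a.s. limit, nonrandom); equivalently, it is the expectation of the one-step conditional mean increment vector of $X^A$ under the stationary distribution of $\mathcal L^A$. For nonempty $A$, $\mathcal D^A_{stable}=\{B\in\mathcal P(D\setminus A): A\cup B\in\mathcal D_{stable}\}$. Partition. Let $\{(K_A,u_A): A\in\mathcal P(D),\ A\ne\emptyset\}$ be a set of positive integer parameters with $K_A>\max_{B\in\mathcal P(D),|B|>|A|}K_B+u_A$ for all nonempty $A$ (the maximum over the empty set being $0$). For $A\in\mathcal P(D)$, $\mathcal V_A$ is the set of $(x,j)\in\mathcal S$ with $x(A)\ge K_A$ (no condition if $A=\emptyset$) for which there is no $C\in\mathcal P(D)$ with $|C|>|A|$ and $x(C)\ge K_C$. The sets $\mathcal V_A$ partition $\mathcal S$. Sets attached to $f$, the constant $c$ and the partition: $\mathcal A_f=\{(x,j)\in\mathcal S: f(x)>c\}$, where $c$ is a sufficiently large constant; $\mathcal A_f^C=\mathcal S\setminus\mathcal A_f$; $\mathcal D_f=\{A\in\mathcal P(D):\mathcal V_A\cap\mathcal A_f\neq\emptyset\}$; $\mathcal D_{f,stable}=\{A\cup B: A\in\mathcal D_f,\ B\in\mathcal D^A_{stable}\}$; and $\mathcal I_{f,A}=\{k\in\{1,\dots,m\}: f(x)=f_k(x)\text{ for some }(x,j)\in\mathcal V_A\}$. *)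

(* Defs.v *)
From HB Require Import structures.
From mathcomp Require Import all_boot all_order all_algebra.
From mathcomp Require Import all_classical all_reals all_analysis.
Set Implicit Arguments.
Unset Strict Implicit.
Unset Printing Implicit Defensive.
Import Order.TTheory GRing.Theory Num.Theory.
Import numFieldNormedType.Exports.
Local Open Scope classical_set_scope.
Local Open Scope ring_scope.

(* A process with values in T together with a family of laws:
   [law s] is the probability conditional on the initial state s. *)
Record process (R : realType) (T : Type) := Process {
  proc_disp : measure_display;
  proc_space : measurableType proc_disp;
  law : T -> probability proc_space R;
  traj : nat -> proc_space -> T
}.

(* Homogeneous Markov chain on the (countable) set S with one-step transition
   probabilities P. The Markov property
     P(Y_{n+1} = h_{n+1} | Y_n = h_n, ..., Y_0 = h_0) = P(h_n, h_{n+1})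
   is multiplied out, so that null conditioning events need no convention. *)
Record markov_chain (R : realType) (T : countType) (S : set T)
    (P : T -> T -> R) (L : process R T) : Prop := MarkovChain {
  traj_in : forall n w, S (traj (p := L) n w);
  traj_measurable :
    forall n s, measurable (traj (p := L) n @^-1` [set s]);
  law_init :
    forall s, S s -> law L s [set w | traj 0 w = s] = 1%E;
  law_step :
    forall s (h : nat -> T) n, S s -> (forall k, S (h k)) ->
    law L s [set w | forall k, (k <= n.+1)%N -> traj k w = h k] =
    (law L s [set w | forall k, (k <= n)%N -> traj k w = h k] *
     (P (h n) (h n.+1))%:E)%E
}.

Section Classification.
Context (R : realType) (T : countType).
Implicit Types (S C : set T) (L : process R T) (s t : T).

Definition accessible L s t : Prop :=
  exists n, (0 < law L s [set w | traj n w = t])%E.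

Definition irreducible_class S L C : Prop :=
  [/\ C `<=` S, C !=set0,
      forall s t, C s -> S t -> accessible L s t -> C t &
      forall s t, C s -> C t -> accessible L s t].

Definition semi_irreducible S L (S0 : set T) : Prop :=
  [/\ irreducible_class S L S0,
      forall C, irreducible_class S L C -> C = S0 &
      forall s t, S s -> S0 t -> accessible L s t].

(* First time n >= 1 at which the path is in C, +oo if there is none: the
   return time when started in C, the first passage time otherwise. *)
Definition passage_time L C (w : proc_space L) : \bar R :=
  ereal_inf [set (n%:R)%:E | n in [set n : nat | (0 < n)%N /\ C (traj n w)]].

Definition passage_finite L s C : Prop :=
  law L s [set w | (passage_time C w < +oo)%E] = 1%E.

Definition passage_integrable L s C : Prop :=
  (\int[law L s]_w passage_time C w < +oo)%E.

Definition positive_recurrent L s : Prop :=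
  passage_finite L s [set s] /\ passage_integrable L s [set s].

Definition transient L s : Prop :=
  (law L s [set w | (passage_time [set s] w < +oo)%E] < 1)%E.

Definition stable S L (S0 : set T) : Prop :=
  (forall s, S0 s -> positive_recurrent L s) /\
  (forall s, S s -> ~ S0 s ->
     passage_finite L s S0 /\ passage_integrable L s S0).

Definition unstable S L (S0 : set T) : Prop :=
  (forall s, S0 s -> transient L s) \/
  (exists s, [/\ S s, ~ S0 s &
     (0 < law L s [set w | forall n, ~ S0 (traj n w)])%E]).

Definition semi_irreducible_stable S L : Prop :=
  exists S0 : set T, semi_irreducible S L S0 /\ stable S L S0.

Definition transient_chain S L : Prop := forall s, S s -> transient L s.

End Classification.

(* States are pairs (x, j) with x in Z^d and j in S^A = {1, ..., s A}, where A
   is determined by x. Coordinates are indexed by 'I_d. *)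
Notation state d := ('rV[int]_d * nat)%type.

Section MMRRW.
Context (R : realType) (d : nat).
Variables (s : {set 'I_d} -> nat).
(* [p A B z i j] is p_z^{A,B}(i,j) *)
Variables (p : {set 'I_d} -> {set 'I_d} -> 'rV[int]_d -> nat -> nat -> R).
Implicit Types (A B : {set 'I_d}) (x : 'rV[int]_d) (y : state d).

(* A :|: B for the unique B disjoint from A with x in \hat B^{A,B} (provided
   x(D\A) >= 0); for A = set0 it is the set of positive coordinates of x. *)
Definition face A x : {set 'I_d} := A :|: [set l | 0 < x ord0 l]%SET.

Definition expanded_space A : set (state d) :=
  [set y : state d | (forall l, l \notin A -> 0 <= y.1 ord0 l) /\
           (1 <= y.2 <= s (face A y.1))%N].

Definition expanded_trans A (y y' : state d) : R :=
  if [forall l, `|y'.1 ord0 l - y.1 ord0 l| <= 1]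
  then p (face A y.1) (face A y'.1) (y'.1 - y.1) y.2 y'.2
  else 0.

Definition is_expanded_chain A (L : process R (state d)) : Prop :=
  markov_chain (expanded_space A) (expanded_trans A) L.

Definition mmrrw_space : set (state d) := expanded_space finset.set0.

(* For A = set0 the expanded space and transition probabilities are those of
   the reflecting random walk itself. *)
Definition is_mmrrw (L : process R (state d)) : Prop :=
  is_expanded_chain finset.set0 L.

(* x(D\A) is represented by x with the coordinates in A set to 0. *)
Definition erase A x : 'rV[int]_d :=
  \row_l (if l \in A then 0 else x ord0 l).

Definition induced_space A : set (state d) :=
  [set y : state d | expanded_space A y /\ forall l, l \in A -> y.1 ord0 l = 0].

(* The process (X^A_n(D\A), J^A_n). Its law from (x(D\A), j) is taken to be the
   law of the expanded chain started with x(A) = 0; the starting value of x(A)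
   is irrelevant since the expanded chain is homogeneous in x(A). *)
Definition induced_chain A (LA : process R (state d)) : process R (state d) :=
  Process (law LA)
    (fun n w => (erase A (traj (p := LA) n w).1, (traj (p := LA) n w).2)).

(* Lhat A is the expanded chain with index A *)
Variable Lhat : {set 'I_d} -> process R (state d).

Definition induced_stable A : Prop :=
  semi_irreducible_stable (induced_space A) (induced_chain A (Lhat A)).

Definition induced_transient A : Prop :=
  transient_chain (induced_space A) (induced_chain A (Lhat A)).

Definition D_stable : set {set 'I_d} :=
  [set A | A != finset.set0 /\ induced_stable A].

(* Only meaningful for nonempty A; set to be empty for A = set0, which does not
   matter for D_f_stable when c is large since V_ set0 is finite. *)
Definition D_stable_over A : set {set 'I_d} :=
  [set B : {set 'I_d} |
     [/\ A != finset.set0, B \subset ~: A & D_stable (A :|: B)]].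

Definition is_mean_drift A (a : 'rV[R]_d) : Prop :=
  forall y, expanded_space A y ->
  {ae law (Lhat A) y, forall w : proc_space (Lhat A), forall l : 'I_d,
    (fun n : nat =>
       ((traj n w).1 ord0 l - (traj 0 w).1 ord0 l)%:~R / n%:R : R)
    @ \oo --> a ord0 l}.

Definition partition_params (K u : {set 'I_d} -> nat) : Prop :=
  forall A, A != finset.set0 ->
  [/\ (0 < K A)%N, (0 < u A)%N &
      ((\max_(B : {set 'I_d} | (#|A| < #|B|)%N) K B) + u A < K A)%N].

Definition V_ (K : {set 'I_d} -> nat) A : set (state d) :=
  [set y : state d | [/\ mmrrw_space y,
     forall l, l \in A -> ((K A)%:Z <= y.1 ord0 l) &
     ~ exists C : {set 'I_d}, (#|A| < #|C|)%N /\
         forall l, l \in C -> ((K C)%:Z <= y.1 ord0 l)]].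

Definition inner (x w : 'rV[R]_d) : R := \sum_l x ord0 l * w ord0 l.

Definition toR x : 'rV[R]_d := map_mx intr x.

(* There are m.+1 >= 1 linear functions; the base point of the maximum is one
   of them, hence harmless. *)
Variables (m : nat) (w : 'I_m.+1 -> 'rV[R]_d).

Definition f_ (k : 'I_m.+1) (x : 'rV[R]_d) : R := inner x (w k).

Definition fmax (x : 'rV[R]_d) : R :=
  \big[Num.max/f_ ord0 x]_(k < m.+1) f_ k x.

Definition A_f (c : R) : set (state d) :=
  [set y : state d | mmrrw_space y /\ c < fmax (toR y.1)].

Definition A_fC (c : R) : set (state d) := mmrrw_space `\` A_f c.

Definition D_f (K : {set 'I_d} -> nat) (c : R) : set {set 'I_d} :=
  [set A | V_ K A `&` A_f c !=set0].

Definition D_f_stable (K : {set 'I_d} -> nat) (c : R) : set {set 'I_d} :=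
  [set E | exists A B : {set 'I_d},
     [/\ D_f K c A, D_stable_over A B & E = A :|: B]].

Definition I_f (K : {set 'I_d} -> nat) A : set 'I_m.+1 :=
  [set k | exists2 y, V_ K A y & fmax (toR y.1) = f_ k (toR y.1)].

End MMRRW.

(* Main.v *)
Require Import Defs.
From HB Require Import structures.
From mathcomp Require Import all_boot all_order all_algebra.
From mathcomp Require Import all_classical all_reals all_analysis.
From mathcomp Require Import ring lra zify.
Set Implicit Arguments.
Unset Strict Implicit.
Unset Printing Implicit Defensive.
Import Order.TTheory GRing.Theory Num.Theory.
Import numFieldNormedType.Exports.
Local Open Scope classical_set_scope.
Local Open Scope ring_scope.

(* Idea: [f] itself is a Lyapunov function. On the part of the state space where
   [f] is large, within a bounded number of steps depending on the state, [f]
   increases by at least 1 in mean. This is shown by downward induction on the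
   number of large coordinates. Near the interior of a face [A] the chain
   behaves like the expanded chain with index [A]: if [L^A] is stable, the law
   of large numbers and the convexity of [f] give the increase; if [L^A] is
   transient, the chain spends a bounded expected time near the face, and the
   remaining time among states with more large coordinates. As [f] has bounded
   jumps, an exponential supermartingale shows that a start with [f] large has
   probability at least 1/2 of never reaching a given level set of [f]. If [f]
   is bounded on [S0], this exhibits a state from which [S0] may never be
   reached; otherwise every state of [S0] can reach a state of [S0] with [f] so
   large that returning has probability at most 1/2, hence is transient. *)

(** * Markov kernels with finitely many moves *)

Section Kernel.
Context (R : realType) (T : countType) (U : finType).
Context (S : set T) (P : T -> T -> R) (step : T -> U -> T).

(* [P] is unconstrained outside [S], hence the restriction. *)
Definition kstep (s : T) (u : U) : R :=
  if `[< S (step s u) >] then P s (step s u) else 0.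

Definition kop (g : T -> R) (s : T) : R := \sum_u kstep s u * g (step s u).

Definition stochastic : Prop :=
  (forall s u, S s -> 0 <= kstep s u) /\
  (forall s, S s -> \sum_u kstep s u = 1).

Hypothesis Kst : stochastic.

Lemma kop_le g g' s : S s ->
  (forall u, S (step s u) -> g (step s u) <= g' (step s u)) ->
  kop g s <= kop g' s.
Proof.
move=> Ss le_g; apply: ler_sum => u _.
have := Kst.1 s u Ss; rewrite /kstep; case: asboolP => Su K0; last by rewrite !mul0r.
by apply: ler_wpM2l => //; exact: le_g.
Qed.

Lemma kop_eq g g' s :
  (forall u, S (step s u) -> g (step s u) = g' (step s u)) ->
  kop g s = kop g' s.
Proof.
move=> eq_g; apply: eq_bigr => u _; rewrite /kstep.
by case: asboolP => Su; [rewrite eq_g | rewrite !mul0r].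
Qed.

Lemma kop_cst (x : R) s : S s -> kop (fun=> x) s = x.
Proof. by move=> Ss; rewrite /kop -big_distrl /= Kst.2 // mul1r. Qed.

Lemma kopD g g' s : kop (fun t => g t + g' t) s = kop g s + kop g' s.
Proof. by rewrite -big_split; apply: eq_bigr => u _; rewrite mulrDr. Qed.

Lemma kopZ (x : R) g s : kop (fun t => x * g t) s = x * kop g s.
Proof. by rewrite big_distrr; apply: eq_bigr => u _ /=; rewrite mulrCA. Qed.

Lemma kopB g g' s : kop (fun t => g t - g' t) s = kop g s - kop g' s.
Proof.
rewrite -[- kop g' s]mulN1r -kopZ -kopD; apply: kop_eq => u _.
by rewrite mulN1r.
Qed.

Lemma kop_sum (I : finType) (g : I -> T -> R) s :
  kop (fun t => \sum_i g i t) s = \sum_i kop (g i) s.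
Proof.
by rewrite exchange_big /=; apply: eq_bigr => u _; rewrite big_distrr.
Qed.

Lemma iter_kop_cst n (x : R) s : S s -> iter n kop (fun=> x) s = x.
Proof.
elim: n s => [//|n IHn] s Ss /=.
rewrite -[RHS](kop_cst x Ss); apply: kop_eq => u Su; exact: IHn.
Qed.

Lemma iter_kopD n g g' s :
  iter n kop (fun t => g t + g' t) s = iter n kop g s + iter n kop g' s.
Proof.
elim: n s => [//|n IHn] s /=; rewrite -kopD; apply: kop_eq => u _; exact: IHn.
Qed.

Lemma iter_kopZ n (x : R) g s :
  iter n kop (fun t => x * g t) s = x * iter n kop g s.
Proof.
elim: n s => [//|n IHn] s /=; rewrite -kopZ; apply: kop_eq => u _; exact: IHn.
Qed.

Lemma iter_kopB n g g' s :
  iter n kop (fun t => g t - g' t) s = iter n kop g s - iter n kop g' s.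
Proof.
elim: n s => [//|n IHn] s /=; rewrite -kopB; apply: kop_eq => u _; exact: IHn.
Qed.

Lemma iter_kop_sum n (I : finType) (g : I -> T -> R) s :
  iter n kop (fun t => \sum_i g i t) s = \sum_i iter n kop (g i) s.
Proof.
elim: n s => [//|n IHn] s /=; rewrite -kop_sum; apply: kop_eq => u _; exact: IHn.
Qed.

Lemma iter_kop_le n g g' s : S s -> (forall t, S t -> g t <= g' t) ->
  iter n kop g s <= iter n kop g' s.
Proof.
move=> Ss le_g; elim: n s Ss => [|n IHn] s Ss /=; first exact: le_g.
by apply: kop_le => // u; exact: IHn.
Qed.

Definition chi (C : set T) (s : T) : R := `[< C s >]%:R.

Lemma chi_ge0 C s : 0 <= chi C s. Proof. exact: ler0n. Qed.

(* Probability that the [k]-th state of the path from [s] is in the [k]-th set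
   of the list, for all [k]. *)
Fixpoint path_prob (l : seq (set T)) (s : T) : R :=
  if l is C :: l' then chi C s * kop (path_prob l') s else 1.

(** Probability that the path from [s] is in [C] at one of the times 0, ..., [n]. *)
Fixpoint hit (C : set T) (n : nat) (s : T) : R :=
  if `[< C s >] then 1 else
  if n is m.+1 then kop (hit C m) s else 0.

Lemma hit_avoid C n s : S s -> hit C n s = 1 - path_prob (nseq n.+1 (~` C)) s.
Proof.
elim: n s => [|n IHn] s Ss /=; rewrite /chi asbool_neg.
  by rewrite kop_cst // mulr1; case: asboolP => Cs; rewrite ?subr0 ?subrr.
case: asboolP => Cs; first by rewrite mul0r subr0.
rewrite mul1r -[X in X - _](kop_cst 1 Ss) -kopB.
by apply: kop_eq => u Su; exact: IHn.
Qed.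

Lemma hit_ge0 C n s : S s -> 0 <= hit C n s.
Proof.
elim: n s => [|n IHn] s Ss /=; case: asboolP => // _.
by rewrite -[X in X <= _](kop_cst 0 Ss); apply: kop_le => // u; exact: IHn.
Qed.

Lemma hit_le1 C n s : S s -> hit C n s <= 1.
Proof.
elim: n s => [|n IHn] s Ss /=; case: asboolP => // _.
by rewrite -[X in _ <= X](kop_cst 1 Ss); apply: kop_le => // u; exact: IHn.
Qed.

Lemma hit_in C n s : C s -> hit C n s = 1.
Proof. by move=> Cs; case: n => [|n] /=; rewrite asboolT. Qed.

Lemma hit_leS C n s : S s -> hit C n s <= hit C n.+1 s.
Proof.
elim: n s => [|n IHn] s Ss; first by rewrite /=; case: asboolP => // ?;
  rewrite -[X in X <= _](kop_cst 0 Ss); apply: kop_le => // u Su; case: asboolP.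
by rewrite [X in X <= _]/= [X in _ <= X]/=; case: asboolP => // Cs;
  apply: kop_le => // u; exact: IHn.
Qed.

Lemma hit_mono C n n' s : S s -> (n <= n')%N -> hit C n s <= hit C n' s.
Proof.
move=> Ss /subnK <-; elim: (n' - n)%N => [//|k IHk].
exact: le_trans IHk (hit_leS _ _ Ss).
Qed.

Lemma hit_subset C C' n s : S s -> C `<=` C' -> hit C n s <= hit C' n s.
Proof.
move=> Ss CC'; elim: n s Ss => [|n IHn] s Ss /=; case: asboolP => Cs.
- by rewrite asboolT //; exact: CC'.
- by case: asboolP.
- by rewrite asboolT //; exact: CC'.
case: asboolP => _; last by apply: kop_le => // u; exact: IHn.
by rewrite -[X in _ <= X](kop_cst 1 Ss); apply: kop_le => // u; exact: hit_le1.
Qed.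

(* The expected number of visits is at most [(1 - r)^-1] times the probability
   of at least one visit, since each visit is followed by another with
   probability at most [r]. *)
Lemma visits_le C (r : R) : r < 1 ->
  (forall n s, S s -> C s -> kop (hit C n) s <= r) ->
  forall n s, S s -> \sum_(i < n) iter i kop (chi C) s <= (1 - r)^-1.
Proof.
move=> r1 Hr n s Ss; set B := (1 - r)^-1.
have r10 : 0 < 1 - r by rewrite subr_gt0.
have B0 : 0 <= B by rewrite invr_ge0 ltW.
suff main : forall s, S s -> \sum_(i < n.+1) iter i kop (chi C) s <= B * hit C n s.
  apply: le_trans (le_trans (main s Ss) _); last by rewrite ler_piMr // hit_le1.
  rewrite big_ord_recr /= lerDl -[X in X <= _](iter_kop_cst n 0 Ss).
  by apply: iter_kop_le => // t _; exact: chi_ge0.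
elim: n {s Ss} => [|n IHn] s Ss.
  rewrite big_ord_recl big_ord0 addr0 /= /chi; case: asboolP => Cs; last by rewrite mulr0.
  rewrite mulr1 invf_ge1 // gerBl; apply: le_trans (Hr 0%N s Ss Cs).
  by rewrite -[X in X <= _](kop_cst 0 Ss); apply: kop_le => // u; exact: hit_ge0.
rewrite big_ord_recl /= -kop_sum /chi; case: asboolP => Cs; last first.
  by rewrite add0r -kopZ; apply: kop_le => // u; exact: IHn.
(* One visit now, then at most [B] times the probability [r] of coming back; [B] solves
   [1 + B * r = B]. *)
rewrite mulr1; apply: (@le_trans _ _ (1 + B * r)).
  rewrite lerD2l; apply: le_trans (ler_wpM2l B0 (Hr n s Ss Cs)).
  by rewrite -kopZ; apply: kop_le => // u; exact: IHn.
by rewrite -lerBrDr -{1}[B]mulr1 -mulrBr mulVf // gt_eqF.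
Qed.
End Kernel.

(** * Laws of Markov chains *)

Lemma measure_big_disjoint d (X : measurableType d) (R : realType)
    (mu : {measure set X -> \bar R}) (I : eqType) (r : seq I) (F : I -> set X) :
  uniq r -> (forall i, measurable (F i)) ->
  (forall i j w, F i w -> F j w -> i = j) ->
  (mu (\big[setU/set0]_(i <- r) F i) = \sum_(i <- r) mu (F i))%E.
Proof.
move=> + mF F_inj; elim: r => [|i r IHr] /=; first by rewrite !big_nil measure0.
move=> /andP[ir ur]; rewrite !big_cons -IHr // measureU //.
  by apply: bigsetU_measurable => j _.
rewrite big_seq; elim/big_ind: _ => [|A B A0 B0|j jr]; rewrite ?setI0 //.
  by rewrite setIUr A0 B0 setU0.
apply/seteqP; split => w //= [Fi Fj]; move: ir.
by rewrite (F_inj _ _ _ Fi Fj) jr.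
Qed.

Lemma measure_bigcup_le d (X : measurableType d) (R : realType)
    (mu : {measure set X -> \bar R}) (F : (set X)^nat) (b : \bar R) :
  (forall n, measurable (F n)) -> nondecreasing_seq F ->
  (forall n, (mu (F n) <= b)%E) -> (mu (\bigcup_n F n) <= b)%E.
Proof.
move=> mF ndF Fb.
have cF := nondecreasing_cvg_mu (mu := mu) mF (bigcup_measurable (fun k _ => mF k)) ndF.
rewrite -(cvg_lim _ cF) //; apply: lime_le; first by apply/cvg_ex; exists (mu (\bigcup_n F n)).
by apply: nearW => n; exact: Fb.
Qed.

Lemma passage_time_ltyP (R : realType) (T : countType) (L : process R T) C w :
  (passage_time (L := L) C w < +oo)%E <-> exists2 n, (0 < n)%N & C (traj n w).
Proof.
split => [/ereal_inf_lt[_ [n [n0 Cn] <-] _]|[n n0 Cn]]; first by exists n.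
apply: (@le_lt_trans _ _ (n%:R)%:E); last exact: ltry.
by apply: ereal_inf_lbound; exists n.
Qed.

Section Law.
Context (R : realType) (T : countType) (U : finType).
Context (S : set T) (P : T -> T -> R) (step : T -> U -> T).
Context (L : process R T).
Hypothesis mc : markov_chain S P L.
(** Moves label successors: a sum over moves counts none twice, and by [step_supp] misses none of
    nonzero weight. *)
Hypothesis step_inj : forall s, injective (step s).
Hypothesis step_supp : forall s t, S s -> S t -> P s t != 0 ->
  exists u, t = step s u.

Local Notation X := (traj (p := L)).
Local Notation ks := (kstep S P step).
Local Notation pp := (path_prob S P step).

Lemma measurable_traj n (C : set T) : measurable (X n @^-1` C).
Proof.
have -> : X n @^-1` C = \bigcup_(s : T) (X n @^-1` [set t | t = s /\ C s]).
  apply/seteqP; split => w /=; last by case=> s _ [/= ->].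
  by move=> Cw; exists (X n w).
apply: countable_bigcupT_measurable => [|s]; first exact: countableP.
have [Cs|Cs] := pselect (C s).
  rewrite (_ : [set _ | _] = [set s]); first exact: (traj_measurable mc).
  by apply/seteqP; split => t /=; [case|].
rewrite (_ : [set _ | _] = set0) ?preimage_set0 //.
by apply/seteqP; split => t //= [].
Qed.

Definition cyl (h : nat -> T) n : set (proc_space L) :=
  [set w | forall k, (k <= n)%N -> X k w = h k].

Lemma measurable_cyl h n : measurable (cyl h n).
Proof.
rewrite (_ : cyl h n = \bigcap_(k in [set k | (k <= n)%N]) X k @^-1` [set h k]) //.
by apply: bigcap_measurable => [|k _]; [exists 0%N|exact: measurable_traj].
Qed.

(** After [h], a next state not of the form [step (h n) u] has transition probability 0 or lies
    outside [S]; as [T] is countable, the paths through such states form a null set. *)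
Lemma law_split s h n (B : set (proc_space L)) :
  S s -> (forall k, S (h k)) -> measurable B -> B `<=` cyl h n ->
  law L s B = (\sum_u law L s (B `&` X n.+1 @^-1` [set step (h n) u]))%E.
Proof.
move=> Ss Sh mB Bh; set mu := law L s.
set F := fun u => B `&` X n.+1 @^-1` [set step (h n) u].
have mF u : measurable (F u) by apply: measurableI => //; exact: measurable_traj.
pose V : set (proc_space L) := \big[setU/set0]_(u : U) F u.
have VF u w : F u w -> V w by move=> Fw; rewrite /V (bigD1 u) //; left.
have mV : measurable V by apply: bigsetU_measurable.
have BV0 : mu (B `\` V) = 0%E.
  apply: measure_negligible; first exact: measurableD.
  apply: (@negligibleS _ _ _ _ (\bigcup_k
    (if unpickle k is Some t then (B `\` V) `&` X n.+1 @^-1` [set t] else set0))).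
    move=> w BVw; exists (pickle (X n.+1 w)) => //.
    by rewrite pickleK.
  apply: negligible_bigcup => k; case: unpickle => [t|]; last exact: negligible_set0.
  have [[u ut]|nut] := pselect (exists u, t = step (h n) u).
    rewrite (_ : _ `&` _ = set0); first exact: negligible_set0.
    apply/seteqP; split => w //= -[[Bw nVw] Xt]; apply: nVw.
    by apply: (VF u); split => //=; rewrite Xt.
  have [St|St] := pselect (S t); last first.
    rewrite (_ : _ `&` _ = set0); first exact: negligible_set0.
    by apply/seteqP; split => w //= -[_ Xt]; apply: St; rewrite -Xt; exact: traj_in mc _ _.
  pose h' k := if (k <= n)%N then h k else t.
  have Pt0 : P (h n) t = 0.
    by apply: contrapT => /eqP Pt; apply: nut; exact: step_supp.
  apply: (@negligibleS _ _ _ _ (cyl h' n.+1)).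
    move=> w /= [[Bw _] Xt] i; rewrite leq_eqVlt => /orP[/eqP ->|].
      by rewrite /h' ltnn.
    by rewrite ltnS => kn; rewrite /h' kn; exact: Bh.
  apply/negligibleP; first exact: measurable_cyl.
  apply: etrans (law_step mc n Ss (h := h') _) _; first by move=> i; rewrite /h'; case: ifP.
  by rewrite /h' leqnn ltnn Pt0 mule0.
rewrite [in LHS](_ : B = V `|` (B `\` V)); last first.
  rewrite setDUK // /V; elim/big_ind: _ => // [A A' AB A'B w [/AB|/A'B] //|u _ w [] //].
rewrite measureU0 //; last exact: measurableD.
apply: measure_big_disjoint => [|//|u v w [_ /= Xu] [_ /= Xv]].
  exact: index_enum_uniq.
by apply: (step_inj (s := h n)); rewrite -Xu.
Qed.

Lemma cyl0 s : law L s (cyl (fun=> s) 0) = law L s [set w | X 0 w = s].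
Proof.
congr (law L s _); apply/seteqP; split => w /=; first exact.
by move=> X0 k; rewrite leqn0 => /eqP ->.
Qed.

Lemma cyl_step h n t :
  cyl h n `&` X n.+1 @^-1` [set t] =
  cyl (fun k => if (k <= n)%N then h k else t) n.+1.
Proof.
apply/seteqP; split => w /=.
  move=> [Hw Xu] k; rewrite leq_eqVlt => /orP[/eqP ->|]; first by rewrite ltnn.
  by rewrite ltnS => kn; rewrite kn; exact: Hw.
move=> Hw; split; last by rewrite Hw // ltnn.
by move=> k kn; rewrite Hw ?(leq_trans kn) // kn.
Qed.

Lemma law_step1 s h n u : S s -> (forall k, S (h k)) ->
  law L s (cyl h n `&` X n.+1 @^-1` [set step (h n) u]) =
  (law L s (cyl h n) * (ks (h n) u)%:E)%E.
Proof.
move=> Ss Sh; rewrite /kstep; case: asboolP => Su; last first.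
  rewrite mule0 (_ : _ `&` _ = set0) ?measure0 //.
  by apply/seteqP; split => w //= -[_ Xu]; apply: Su; rewrite -Xu; exact: traj_in mc _ _.
pose h' k := if (k <= n)%N then h k else step (h n) u.
rewrite cyl_step -/h'.
rewrite /cyl (law_step mc) //; last by move=> k; rewrite /h'; case: ifP.
rewrite /h' leqnn ltnn; congr (law L s _ * _)%E.
by apply/seteqP; split => w /= Hw k kn; rewrite Hw // /h' kn.
Qed.

(** The weights from [s] are probabilities of events at time 1 under the law from [s], and these
    events exhaust the law by [law_split]. *)
Lemma markov_stochastic : stochastic S P step.
Proof.
have step1 s u : S s ->
    law L s (cyl (fun=> s) 0 `&` X 1 @^-1` [set step s u]) = (ks s u)%:E.
  by move=> Ss; rewrite law_step1 // cyl0 (law_init mc) // mul1e.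
split => [s u Ss|s Ss]; first by rewrite -lee_fin -step1.
apply: EFin_inj; rewrite -sumEFin -[RHS](law_init mc Ss) -cyl0.
rewrite (@law_split s (fun=> s) 0) //; last exact: measurable_cyl.
by apply: eq_bigr => u _; rewrite step1.
Qed.

Definition future n (l : seq (set T)) : set (proc_space L) :=
  [set w | forall k, (k < size l)%N -> nth setT l k (X (n + k)%N w)].

Lemma future_cons n C l : future n (C :: l) = X n @^-1` C `&` future n.+1 l.
Proof.
apply/seteqP; split => w /=.
  move=> Hw; split; first by have := Hw 0%N isT; rewrite addn0.
  by move=> k kl; have := Hw k.+1 kl; rewrite addnS.
by move=> [Cw Hw] [|k] /= kl; rewrite ?addn0 // addnS; exact: Hw.
Qed.

Lemma measurable_future n l : measurable (future n l).
Proof.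
elim: l n => [|C l IHl] n; last first.
  by rewrite future_cons; apply: measurableI => //; exact: measurable_traj.
by rewrite (_ : future _ _ = setT) //; apply/seteqP; split.
Qed.

(** Markov property for events from time [n] on: splitting by the state at time [n.+1] prolongs the
    cylinder by one step and shortens the list. *)
Lemma law_future s h n l : S s -> (forall k, S (h k)) ->
  law L s (cyl h n `&` future n l) = (law L s (cyl h n) * (pp l (h n))%:E)%E.
Proof.
move=> Ss; elim: l n h => [|C l IHl] n h Sh /=.
  by rewrite mule1 (_ : future _ _ = setT) ?setIT //; apply/seteqP; split.
rewrite future_cons /chi; case: asboolP => Ch; last first.
  rewrite mul0r mule0 (_ : _ `&` _ = set0) ?measure0 //.
  by apply/seteqP; split => w //= -[Hw [Cw _]]; apply: Ch; rewrite -(Hw n).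
rewrite mul1r (_ : cyl h n `&` _ = cyl h n `&` future n.+1 l); last first.
  apply/seteqP; split => w [Hw]; first by case.
  by move=> fw; split => //; split => //=; rewrite (Hw n).
rewrite (@law_split s h n) //; last first.
  by apply: measurableI; [exact: measurable_cyl|exact: measurable_future].
have /fineK <- : law L s (cyl h n) \is a fin_num.
  by apply: fin_num_measure; exact: measurable_cyl.
rewrite -EFinM /kop big_distrr -sumEFin; apply: eq_bigr => u _ /=.
have [Su|Su] := pselect (S (step (h n) u)); last first.
  rewrite /kstep asboolF // mul0r mulr0 (_ : _ `&` _ = set0) ?measure0 //.
  by apply/seteqP; split => w //= -[_ Xu]; apply: Su; rewrite -Xu; exact: traj_in mc _ _.
pose h' k := if (k <= n)%N then h k else step (h n) u.
have Sh' k : S (h' k) by rewrite /h'; case: ifP.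
rewrite setIAC cyl_step IHl // -cyl_step law_step1 //.
rewrite /h' ltnn mulrA !EFinM fineK //.
by apply: fin_num_measure; exact: measurable_cyl.
Qed.

Lemma law_start s (B : set (proc_space L)) : S s -> measurable B ->
  law L s (cyl (fun=> s) 0 `&` B) = law L s B.
Proof.
move=> Ss mB; have mc0 := measurable_cyl (fun=> s) 0.
rewrite [RHS](@measureDI _ _ _ _ B (cyl (fun=> s) 0)) // (_ : _ (_ `\` _) = 0%E).
  by rewrite add0e setIC.
apply: (@subset_measure0 _ _ _ _ _ (~` cyl (fun=> s) 0)) => //.
- exact: measurableD.
- exact: measurableC.
- by rewrite [LHS]probability_setC // cyl0 (law_init mc) // subee.
Qed.

Lemma law_future0 s l : S s -> law L s (future 0 l) = (pp l s)%:E.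
Proof.
move=> Ss; rewrite -law_start //; last exact: measurable_future.
by rewrite law_future // cyl0 (law_init mc) // mul1e.
Qed.

Lemma law_traj s n (C : set T) : S s ->
  law L s (X n @^-1` C) = (iter n (kop S P step) (chi R C) s)%:E.
Proof.
move=> Ss; have -> : X n @^-1` C = future 0 (rcons (nseq n setT) C).
  apply/seteqP; split => w /=.
    move=> Cw k; rewrite size_rcons size_nseq ltnS nth_rcons size_nseq nth_nseq.
    by case: ltngtP => // ->.
  move=> /(_ n); rewrite size_rcons size_nseq ltnSn nth_rcons size_nseq ltnn eqxx.
  exact.
rewrite law_future0 //; congr EFin; elim: n s Ss => [|n IHn] s Ss /=.
  by rewrite kop_cst ?mulr1 //; exact: markov_stochastic.
rewrite /chi asboolT // mul1r; apply: kop_eq => u Su; exact: IHn.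
Qed.

Lemma law_avoid s n (C : set T) : S s ->
  law L s [set w | forall k, (k <= n)%N -> ~ C (X k w)] = (1 - hit S P step C n s)%:E.
Proof.
move=> Ss; rewrite hit_avoid //; last exact: markov_stochastic.
rewrite subKr -law_future0 //; congr (law L s _).
apply/seteqP; split => w Hw k.
  by rewrite size_nseq nth_nseq => kn; rewrite kn; apply: Hw; rewrite -ltnS.
by move=> kn; have := Hw k; rewrite size_nseq nth_nseq ltnS kn; exact.
Qed.

Lemma law_avoid_after s n (C : set T) : S s ->
  law L s [set w | forall k, (0 < k <= n.+1)%N -> ~ C (X k w)] =
  (1 - kop S P step (hit S P step C n) s)%:E.
Proof.
move=> Ss; have K := markov_stochastic.
have -> : [set w | forall k, (0 < k <= n.+1)%N -> ~ C (X k w)] =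
    future 0 (setT :: nseq n.+1 (~` C)).
  apply/seteqP; split => w Hw [|k] //.
    by rewrite [size _]/= size_nseq ltnS -[nth _ _ _]/(nth setT (nseq n.+1 (~` C)) k) nth_nseq;
      move=> kn; rewrite kn; apply: Hw.
  move=> /= kn; have := Hw k.+1; rewrite [size _]/= size_nseq ltnS.
  by rewrite -[nth _ _ _]/(nth setT (nseq n.+1 (~` C)) k) nth_nseq kn; exact.
rewrite law_future0 // [pp _ _]/= /chi asboolT // mul1r.
rewrite -[X in (X - _)%:E](kop_cst K 1 Ss) -kopB; congr EFin.
by apply: kop_eq => u Su; rewrite hit_avoid // subKr.
Qed.

Definition visit (I : set nat) (C : set T) : set (proc_space L) :=
  [set w | exists2 k, I k & C (X k w)].

Lemma measurable_visit I C : measurable (visit I C).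
Proof.
rewrite (_ : visit I C = \bigcup_(k in I) X k @^-1` C).
  by apply: bigcup_measurable => k _; exact: measurable_traj.
by apply/seteqP; split => w /= [k]; exists k.
Qed.

Lemma visitC I C : visit I C = ~` [set w | forall k, I k -> ~ C (X k w)].
Proof.
apply/seteqP; split => w /=; first by move=> [k Ik Ck] /(_ k Ik).
by move=> /existsNP[k /not_implyP[Ik /contrapT Ck]]; exists k.
Qed.

Lemma law_visit I C : forall s, S s -> forall r : R,
  law L s [set w | forall k, I k -> ~ C (X k w)] = (1 - r)%:E ->
  law L s (visit I C) = r%:E.
Proof.
move=> s Ss r avoid; rewrite visitC [LHS]probability_setC.
  by rewrite avoid -EFinB subKr.
by rewrite -[mkset _]setCK -visitC; apply: measurableC; exact: measurable_visit.
Qed.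

Lemma law_hit s n (C : set T) : S s ->
  law L s (visit [set k | (k <= n)%N] C) = (hit S P step C n s)%:E.
Proof. by move=> Ss; apply: law_visit => //; exact: law_avoid. Qed.

Lemma law_return s n (C : set T) : S s ->
  law L s (visit [set k | (0 < k <= n.+1)%N] C) =
  (kop S P step (hit S P step C n) s)%:E.
Proof. by move=> Ss; apply: law_visit => //; exact: law_avoid_after. Qed.

Lemma passage_visit (C : set T) :
  [set w | (passage_time (L := L) C w < +oo)%E] = visit [set n | (0 < n)%N] C.
Proof. by apply/seteqP; split => w /= /passage_time_ltyP. Qed.

Lemma measurable_passage (C : set T) :
  measurable [set w | (passage_time (L := L) C w < +oo)%E].
Proof. by rewrite passage_visit; exact: measurable_visit. Qed.

Lemma return_le_passage s n (C : set T) : S s ->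
  ((kop S P step (hit S P step C n) s)%:E <=
   law L s [set w | (passage_time (L := L) C w < +oo)%E])%E.
Proof.
move=> Ss; rewrite -law_return // passage_visit.
apply: le_measure; rewrite ?inE; [exact: measurable_visit..|].
by move=> w [k /andP[k0 _] Ck]; exists k.
Qed.

(** The events of a passage within [n.+1] steps increase to that of a finite passage time. *)
Lemma passage_le s (C : set T) (b : R) : S s ->
  (forall n, kop S P step (hit S P step C n) s <= b) ->
  (law L s [set w | (passage_time (L := L) C w < +oo)%E] <= b%:E)%E.
Proof.
move=> Ss hb; rewrite passage_visit.
have -> : visit [set k | (0 < k)%N] C =
    \bigcup_n visit [set k | (0 < k <= n.+1)%N] C.
  apply/seteqP; split => w /=.
    by case=> k k0 Ck; exists k => //; exists k; rewrite /= ?k0 //=.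
  by case=> n _ [k /andP[k0 _] Ck]; exists k.
apply: measure_bigcup_le => [n|m n mn|n]; first exact: measurable_visit.
  apply/subsetPset => w /= [k /andP[k0 km] Ck]; exists k => //=.
  by rewrite k0 (leq_trans km).
by rewrite [leLHS](law_return n C Ss) lee_fin.
Qed.

Lemma never_hit_gt0 s (C : set T) (b : R) : S s -> b < 1 ->
  (forall n, hit S P step C n s <= b) ->
  (0 < law L s [set w | forall n, ~ C (X n w)])%E.
Proof.
move=> Ss b1 hb.
have -> : [set w | forall n, ~ C (X n w)] =
    ~` \bigcup_n visit [set k | (k <= n)%N] C.
  apply/seteqP; split => w /=; first by move=> Hw [n _ [k _ Ck]]; exact: Hw Ck.
  by move=> Hw n Cn; apply: Hw; exists n => //; exists n => /=.
have mV n := measurable_visit [set k | (k <= n)%N] C.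
rewrite [ltRHS]probability_setC; last exact: bigcup_measurable.
apply: (@lt_le_trans _ _ (1 - b%:E)%E); first by rewrite -EFinB lte_fin subr_gt0.
apply: leeB => //; apply: measure_bigcup_le => // [m n mn|n].
  by apply/subsetPset => w /= [k km Ck]; exists k => //; exact: leq_trans mn.
by rewrite [leLHS](law_hit n C Ss) lee_fin.
Qed.

End Law.

(** * The kernels of the expanded chains *)

Lemma row_eqP (T : Type) d (x x' : 'rV[T]_d) :
  (forall l, x ord0 l = x' ord0 l) -> x = x'.
Proof.
by move=> xx'; apply/matrixP => -[[|i] Hi] l //; rewrite (_ : Ordinal Hi = ord0) //; apply/val_inj.
Qed.

Section ConcreteKernel.
Context (R : realType) (d : nat) (s : {set 'I_d} -> nat).
Context (p : {set 'I_d} -> {set 'I_d} -> 'rV[int]_d -> nat -> nat -> R).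
Implicit Types (A : {set 'I_d}) (y t : state d) (v : 'rV[int]_d).

(** A bound on the phases of all faces makes the moves one finite type: an increment, coded in
    ['I_3] with offset 1, and the new phase. *)
Definition max_phase : nat := \max_A s A.

Local Notation move := ({ffun 'I_d -> 'I_3} * 'I_max_phase.+1)%type.

Definition incr (z : {ffun 'I_d -> 'I_3}) : 'rV[int]_d := \row_l ((z l : nat)%:Z - 1).

Definition mstep y (u : move) : state d := (y.1 + incr u.1, u.2 : nat).

Lemma mstep_inj y : injective (mstep y).
Proof.
move=> [z j] [z' j'] [/addrI zz' /ord_inj ->]; congr (_, _).
apply/ffunP => l; apply: ord_inj; move/rowP/(_ l): zz'; rewrite !mxE.
by move=> /addIr [].
Qed.

Lemma mstep_supp A y t : expanded_space s A y -> expanded_space s A t ->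
  expanded_trans p A y t != 0 -> exists u, t = mstep y u.
Proof.
move=> _ [_ /andP[_ tJ]]; rewrite /expanded_trans; case: forallP => [yt _|]; last first.
  by rewrite eqxx.
have tJ' : (t.2 < max_phase.+1)%N.
  by rewrite ltnS (leq_trans tJ) // (leq_bigmax (F := s)).
have zl l : (`|(t.1 ord0 l - y.1 ord0 l + 1)%R|%N < 3)%N.
  by have := yt l; lia.
exists ([ffun l => Ordinal (zl l)], Ordinal tJ').
case: t {tJ} yt tJ' zl => x j /= yt tJ' zl; congr (_, _).
apply: row_eqP => l; rewrite !mxE ffunE /=; have := yt l; lia.
Qed.

Lemma mstep_dist y u l : `|(mstep y u).1 ord0 l - y.1 ord0 l| <= 1.
Proof. by rewrite !mxE; case: (u.1 l) (y.1 _ _) => [[|[|[|i]]]] //= _ b; lia. Qed.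

Local Notation S := (expanded_space s).
Definition opA A := kop (S A) (expanded_trans p A) mstep.

(** By skip-freeness, [n] steps stay within sup-distance [n] of the start, so only values there
    matter. *)
Lemma iter_local A n g g' y : stochastic (S A) (expanded_trans p A) mstep ->
  S A y ->
  (forall t, S A t -> (forall l, `|t.1 ord0 l - y.1 ord0 l| <= n%:Z) -> g t <= g' t) ->
  iter n (opA A) g y <= iter n (opA A) g' y.
Proof.
move=> K; elim: n y => [|n IHn] y Sy le_g /=.
  by apply: le_g => // l; rewrite subrr normr0.
apply: kop_le => // u Su; apply: IHn => // t St tu; apply: le_g => // l.
by have := tu l; have := mstep_dist y u l; lia.
Qed.

Lemma face_pos A y : (forall l, l \in A -> 0 < y.1 ord0 l) ->
  face A y.1 = face finset.set0 y.1.
Proof.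
move=> y0; apply/setP => l; rewrite !inE.
by case: (boolP (l \in A)) => //= /y0 ->.
Qed.

Lemma expanded_pos A y : (forall l, l \in A -> 0 < y.1 ord0 l) ->
  S A y <-> S finset.set0 y.
Proof.
move=> y0; rewrite /expanded_space /= (face_pos y0).
split => -[yl ->]; split => // l; last by move=> _; apply: yl; rewrite inE.
by move=> _; case: (boolP (l \in A)) => [/y0/ltW|/yl].
Qed.

(** While the coordinates in [A] are positive, the walk and the expanded chain have the same
    transitions, and [n] steps cannot bring these coordinates to 0. *)
Lemma iter_couple A n g y : (forall l, l \in A -> n%:Z < y.1 ord0 l) ->
  iter n (opA finset.set0) g y = iter n (opA A) g y.
Proof.
elim: n y => [//|n IHn] y yA /=.
apply: eq_bigr => u _.
have y0 l : l \in A -> 0 < y.1 ord0 l by move=> /yA; lia.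
have u0 l : l \in A -> n%:Z < (mstep y u).1 ord0 l.
  by move=> /yA; have := mstep_dist y u l; lia.
have u00 l : l \in A -> 0 < (mstep y u).1 ord0 l by move=> /u0; lia.
rewrite IHn //; congr (_ * _); rewrite /kstep.
rewrite (asbool_equiv_eq (expanded_pos u00)).
by rewrite /expanded_trans (face_pos y0) (face_pos u00).
Qed.

(** Used with [v] supported in [A], the directions in which the expanded chain with index [A] is
    homogeneous. *)
Definition shift v y : state d := (y.1 + v, y.2).

Lemma face_shift A v x : (forall l, l \notin A -> v ord0 l = 0) ->
  face A (x + v) = face A x.
Proof.
move=> v0; apply/setP => l; rewrite !inE mxE.
by case: (boolP (l \in A)) => //= /v0 ->; rewrite addr0.
Qed.

Lemma expanded_shift A v y : (forall l, l \notin A -> v ord0 l = 0) ->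
  S A (shift v y) <-> S A y.
Proof.
move=> v0; rewrite /expanded_space /= face_shift //.
by split => -[yl ->]; split => // l lA; have := yl l lA; rewrite mxE v0 // addr0.
Qed.

Lemma mstep_shift v y u : mstep (shift v y) u = shift v (mstep y u).
Proof. by rewrite /mstep /shift /= addrAC. Qed.

Lemma op_shift A v g y : (forall l, l \notin A -> v ord0 l = 0) ->
  opA A g (shift v y) = opA A (g \o shift v) y.
Proof.
move=> v0; apply: eq_bigr => u _; rewrite mstep_shift /=; congr (_ * _).
rewrite /kstep mstep_shift (asbool_equiv_eq (expanded_shift _ v0)).
have E : [forall l, `|(shift v (mstep y u)).1 ord0 l - (shift v y).1 ord0 l| <= 1] =
    [forall l, `|(mstep y u).1 ord0 l - y.1 ord0 l| <= 1].
  by apply: eq_forallb => l; rewrite !mxE opprD addrACA subrr addr0.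
rewrite /expanded_trans E /= !(face_shift _ v0).
by rewrite opprD [_ + v + _]addrACA subrr addr0.
Qed.

Lemma iter_shift A v n g y : (forall l, l \notin A -> v ord0 l = 0) ->
  iter n (opA A) g (shift v y) = iter n (opA A) (g \o shift v) y.
Proof.
move=> v0; elim: n y => [//|n IHn] y /=; rewrite op_shift //.
by apply: kop_eq => u _ /=; exact: IHn.
Qed.

Lemma hit_shift A v C n y : (forall l, l \notin A -> v ord0 l = 0) ->
  (forall t, C (shift v t) <-> C t) ->
  hit (S A) (expanded_trans p A) mstep C n (shift v y) =
  hit (S A) (expanded_trans p A) mstep C n y.
Proof.
move=> v0 Cv; elim: n y => [|n IHn] y /=; rewrite (asbool_equiv_eq (Cv y)) //.
rewrite -!/(opA A _ _) op_shift //; congr (if _ then _ else _).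
by apply: kop_eq => u _ /=; exact: IHn.
Qed.

Lemma shift_erase A y : y = shift (y.1 - erase A y.1) (erase A y.1, y.2).
Proof. by case: y => x j; rewrite /shift /= addrC subrK. Qed.

Lemma erase_diff A (x : 'rV[int]_d) l : l \notin A -> (x - erase A x) ord0 l = 0.
Proof. by move=> lA; rewrite !mxE (negbTE lA) subrr. Qed.

Lemma erase_expanded A y : S A y <-> induced_space s A (erase A y.1, y.2).
Proof.
rewrite [in S A y](shift_erase A y) expanded_shift; last exact: erase_diff.
split => [Sy|[]//]; split => // l lA.
by rewrite mxE lA.
Qed.

End ConcreteKernel.

(** * Piecewise linear functions, visits and mean drifts *)

Section PiecewiseLinear.
Context (R : realType) (d m : nat) (w : 'I_m.+1 -> 'rV[R]_d).
Implicit Types (x : 'rV[int]_d) (y t : state d).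

(** A Lipschitz constant for the sup norm, common to all pieces [fk] and hence valid for [F]. *)
Definition lip : R := \sum_k \sum_l `|w k ord0 l|.

Lemma lip_ge0 : 0 <= lip.
Proof. by apply: sumr_ge0 => k _; apply: sumr_ge0. Qed.

Definition fk k y : R := f_ w k (toR R y.1).
Definition F y : R := fmax w (toR R y.1).

Lemma fkB k y t :
  fk k t - fk k y = \sum_l (t.1 ord0 l - y.1 ord0 l)%:~R * w k ord0 l.
Proof.
rewrite /fk /f_ /inner -sumrB; apply: eq_bigr => l _.
by rewrite !mxE -mulrBl rmorphB.
Qed.

Lemma fk_lip k y t n : (forall l, `|t.1 ord0 l - y.1 ord0 l| <= n%:Z) ->
  `|fk k t - fk k y| <= lip * n%:R.
Proof.
move=> yt; rewrite fkB; apply: le_trans (ler_norm_sum _ _ _) _.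
rewrite /lip (bigD1 k) //= mulrDl big_distrl /= -[X in X <= _]addr0.
apply: lerD; last first.
  by rewrite mulr_ge0 //; apply: sumr_ge0 => i _; apply: sumr_ge0.
apply: ler_sum => l _; rewrite normrM mulrC ler_wpM2l //.
by rewrite -intr_norm -[n%:R]/((n%:Z)%:~R) ler_int; exact: yt.
Qed.

Lemma fk_le_F k y : fk k y <= F y.
Proof. by rewrite /F /fmax; exact: (le_bigmax _ (fun k => f_ w k _)). Qed.

Lemma F_attained y : exists k, F y = fk k y.
Proof.
rewrite /F /fmax; elim/big_ind: _ => [|a b [k ->] [k' ->]|k _]; last 1 first.
- by exists k.
- by exists ord0.
by rewrite /Num.max; case: ifP => _; [exists k'|exists k].
Qed.

(** The piece that is maximal at [y] bounds [F t] from below; exchanging [y] and [t] gives the other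
    inequality. *)
Lemma F_lip y t n : (forall l, `|t.1 ord0 l - y.1 ord0 l| <= n%:Z) ->
  F y - lip * n%:R <= F t.
Proof.
move=> yt; have [k ->] := F_attained y.
by apply: le_trans (fk_le_F k t); have := fk_lip k yt; rewrite ler_norml; lra.
Qed.

Lemma F_scale n x j : F (x *+ n, j) = n%:R * F (x, j).
Proof.
have fkn k : fk k (x *+ n, j) = n%:R * fk k (x, j).
  rewrite /fk /f_ /inner big_distrr; apply: eq_bigr => l _ /=.
  by rewrite !mxE mulrA mulmxnE rmorphMn /= mulr_natl.
apply/eqP; rewrite eq_le; apply/andP; split.
  have [k ->] := F_attained (x *+ n, j).
  by rewrite fkn ler_wpM2l // fk_le_F.
have [k ->] := F_attained (x, j).
by rewrite -fkn fk_le_F.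
Qed.

End PiecewiseLinear.

Lemma cvgr_sum (R : realType) (I : Type) (r : seq I) (u : I -> nat -> R) (a : I -> R) :
  (forall i, u i n @[n --> \oo] --> a i) ->
  \sum_(i <- r) u i n @[n --> \oo] --> \sum_(i <- r) a i.
Proof.
move=> ua; elim: r => [|i r IHr].
  by under eq_fun do rewrite big_nil; rewrite big_nil; exact: cvg_cst.
by under eq_fun do rewrite big_cons; rewrite big_cons; apply: cvgD.
Qed.

Section Drift.
Context (R : realType) (d : nat) (s : {set 'I_d} -> nat).
Context (p : {set 'I_d} -> {set 'I_d} -> 'rV[int]_d -> nat -> nat -> R).
Context (Lhat : {set 'I_d} -> process R (state d)).
Context (m : nat) (w : 'I_m.+1 -> 'rV[R]_d).
Context (A : {set 'I_d}).
Hypothesis chainA : is_expanded_chain s p A (Lhat A).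
Implicit Types (y t : state d).

Local Notation S := (expanded_space s).
Local Notation J := (max_phase s).
Local Notation op := (@opA R d s p A).

Lemma stochA : stochastic (S A) (expanded_trans p A) (@mstep d s).
Proof. exact: markov_stochastic chainA (@mstep_inj d s) (@mstep_supp R d s p A). Qed.

(** Transience gives a return probability [q < 1] at [tau], and [visits_le] turns it into a bound on
    visits. By translation along [A], the same [q] serves every state that erases to [tau]. *)
Lemma visits_erased (tau : state d) : induced_transient s Lhat A ->
  exists G : R, forall n y, S A y ->
    \sum_(i < n) iter i op (chi R [set t : state d | (erase A t.1, t.2) = tau]) y <= G.
Proof.
move=> trA; set C := [set t | _].
have [tauI|tauI] := pselect (induced_space s A tau); last first.
  exists 0 => n y Sy; apply: sumr_le0 => i _.
  rewrite -[X in _ <= X](iter_kop_cst stochA i 0 Sy).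
  apply: (iter_kop_le stochA) => // t St; rewrite /chi asboolF // => tC.
  by apply: tauI; rewrite -tC; exact/erase_expanded.
(* A return of the induced chain to [tau] is a passage of the expanded chain into [C], under the
   same law. *)
have := trA tau tauI; rewrite /transient /=.
set q := law _ _ _ => q1.
have q0 : q \is a fin_num.
  by apply: fin_num_measure; exact: (measurable_passage chainA C).
exists (1 - fine q)^-1 => n y Sy; apply: (visits_le stochA) => // [|{}n {}y {}Sy Cy].
  by rewrite -lte_fin fineK.
rewrite (shift_erase A y) -/(op _ _) op_shift; last exact: erase_diff.
rewrite (_ : op _ _ = op (hit (S A) (expanded_trans p A) (@mstep d s) C n)
    (erase A y.1, y.2)).
  rewrite -lee_fin fineK //.
  by have := return_le_passage chainA (@mstep_inj d s) (@mstep_supp R d s p A) n C tauI.1; rewrite Cy.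
apply: kop_eq.
move=> u _ /=; rewrite (@hit_shift R d s p A) // => [|t]; first exact: erase_diff.
rewrite /C /=; suff -> : erase A (t.1 + (y.1 - erase A y.1)) = erase A t.1 by [].
apply: row_eqP => l; rewrite !mxE; case: ifP => // lA.
by rewrite lA subrr addr0.
Qed.

(* With the coordinates in [A] erased, the states whose other coordinates are
   below [M] form a finite set, indexed by this type. *)
Local Notation ftype M := ({ffun 'I_d -> 'I_M} * 'I_J.+1)%type.

Definition tstate M (a : ftype M) : state d :=
  (\row_l (if l \in A then 0 else (a.1 l : nat)%:Z), a.2 : nat).

Definition near_face M : set (state d) :=
  [set y : state d | forall l, l \notin A -> y.1 ord0 l < M%:Z].

Lemma near_face_type M y : (0 < M)%N -> S A y -> near_face M y ->
  exists a : ftype M, (erase A y.1, y.2) = tstate a.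
Proof.
move=> M0 [y0 /andP[_ yJ]] yM.
have jJ : (y.2 < J.+1)%N by rewrite ltnS (leq_trans yJ) // (leq_bigmax (F := s)).
have zM l : ((if l \in A then 0%N else absz (y.1 ord0 l)) < M)%N.
  case: (boolP (l \in A)) => // lA.
  by have := y0 l lA; have := yM l lA; lia.
exists ([ffun l => Ordinal (zM l)], Ordinal jJ).
rewrite /tstate /=; congr (_, _); apply: row_eqP => l; rewrite !mxE ffunE /=.
case: (boolP (l \in A)) => // lA; have := y0 l lA.
lia.
Qed.

(** Up to translation along [A] there are finitely many states near the face; their bounds are
    added. *)
Lemma visits_near_face M : induced_transient s Lhat A -> (0 < M)%N ->
  exists G : R, forall n y, S A y -> \sum_(i < n) iter i op (chi R (near_face M)) y <= G.
Proof.
move=> trA M0.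
have /choice[G GP] : forall a : ftype M, exists G : R, forall n y, S A y ->
    \sum_(i < n) iter i op (chi R [set t : state d | (erase A t.1, t.2) = tstate a]) y <= G.
  by move=> a; exact: visits_erased.
exists (\sum_a G a) => n y Sy.
apply: (@le_trans _ _ (\sum_a \sum_(i < n)
  iter i op (chi R [set t : state d | (erase A t.1, t.2) = tstate a]) y)); last first.
  by apply: ler_sum => a _; exact: GP.
rewrite exchange_big; apply: ler_sum => i _; rewrite -iter_kop_sum.
apply: (iter_kop_le stochA) => // t St; rewrite [X in X <= _]/chi.
case: asboolP => tM; last by apply: sumr_ge0 => a _; exact: chi_ge0.
have [a ta] := near_face_type M0 St tM.
rewrite (bigD1 a) //= /chi asboolT // lerDl; apply: sumr_ge0 => *; exact: chi_ge0.
Qed.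

(** The average gain converges almost surely to [f_ w k a], so almost every path is slow only
    finitely often. The tail unions [G n] of the slow events thus decrease to a null set. *)
Lemma rare_slow (a : 'rV[R]_d) k y : is_mean_drift s Lhat A a -> 0 < f_ w k a ->
  S A y ->
  (fun n => iter n op (chi R [set t : state d | fk w k t - fk w k y < n%:R * (f_ w k a / 2)]) y)
    @ \oo --> (0 : R).
Proof.
move=> aP fa Sy.
pose B n := [set t : state d | fk w k t - fk w k y < n%:R * (f_ w k a / 2)].
have mB n : measurable (traj (p := Lhat A) n @^-1` B n) by exact: (measurable_traj chainA).
set G := fun n => \bigcup_(i in [set i | (n <= i)%N]) (traj (p := Lhat A) i @^-1` B i).
have mG n : measurable (G n) by apply: bigcup_measurable.
have G0 : law (Lhat A) y (\bigcap_n G n) = 0%E.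
  apply: measure_negligible; first by apply: bigcapT_measurable.
  have start0 : (law (Lhat A) y).-negligible (~` [set w | traj (p := Lhat A) 0 w = y]).
    have m0 : measurable [set w | traj (p := Lhat A) 0 w = y].
      exact: (measurable_traj chainA 0 [set y]).
    apply/negligibleP; first exact: measurableC.
    by rewrite [LHS]probability_setC // (law_init chainA) // subee.
  have [N [mN N0 aN]] := negligibleU (aP y Sy) start0.
  exists N; split => // w' Gw; apply: aN; apply: contrapT => /not_orP[/contrapT cw /contrapT X0].
  have cvgk : (fun n => (fk w k (traj n w') - fk w k y) / n%:R) @ \oo --> f_ w k a.
    have -> : (fun n => (fk w k (traj n w') - fk w k y) / n%:R) =
        (fun n => \sum_l ((traj n w').1 ord0 l - (traj 0 w').1 ord0 l)%:~R / n%:R * w k ord0 l).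
      apply/funext => n; rewrite fkB big_distrl X0; apply: eq_bigr => l _ /=.
      by rewrite mulrAC.
    rewrite /f_ /inner; apply: cvgr_sum => l.
    by apply: cvgMr_tmp; exact: cw.
  have : \forall n \near \oo, f_ w k a / 2 < (fk w k (traj n w') - fk w k y) / n%:R.
    by apply: (cvgr_gt (f_ w k a)) => //; lra.
  case=> n0 _ Hn0; have [i /= ni] := Gw n0.+1 I; rewrite /B /=.
  have i0 : 0 < i%:R :> R by rewrite ltr0n; lia.
  move=> Bi; have := Hn0 i (ltnW ni); rewrite /= ltr_pdivlMr // mulrC.
  by move=> /(lt_trans Bi); rewrite ltxx.
have cG : law (Lhat A) y \o G @ \oo --> 0%E.
  rewrite -G0; apply: nonincreasing_cvg_mu => //.
  - by rewrite -ge0_fin_numE // fin_num_measure.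
  - exact: bigcapT_measurable.
  - move=> i j ij; apply/subsetPset => x [n /= jn Bn]; exists n => //=.
    exact: leq_trans ij jn.
have cG' : fine (law (Lhat A) y (G n)) @[n --> \oo] --> (0 : R).
  exact: fine_cvg cG.
apply: (squeeze_cvgr _ (cvg_cst 0) cG'); apply: nearW => n; apply/andP; split.
  rewrite -[X in X <= _](iter_kop_cst stochA n 0 Sy).
  by apply: (iter_kop_le stochA) => // t _; exact: chi_ge0.
rewrite -lee_fin fineK; last by apply: fin_num_measure.
have <- := law_traj chainA (@mstep_inj d s) (@mstep_supp R d s p A) n (B n) Sy.
by apply: le_measure; rewrite ?inE // => x Bx; exists n => /=.
Qed.

Lemma mean_drift_growth (a : 'rV[R]_d) k y :
  is_mean_drift s Lhat A a -> 0 < f_ w k a -> S A y ->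
  \forall n \near \oo, fk w k y + n%:R * (f_ w k a / 4) <= iter n op (fk w k) y.
Proof.
move=> aP fa Sy; set al := f_ w k a.
(* A slow path falls short of the gain [n * al / 2] by at most [n * c]; once slow paths have
   probability at most [al / 4 / c], a mean gain [n * al / 4] remains. *)
pose c := lip w + al / 2.
have c0 : 0 < c by rewrite ltr_wpDl ?lip_ge0 // divr_gt0.
have := cvgr_le 0 (rare_slow aP fa Sy) (al / 4 / c); rewrite !divr_gt0 // => /(_ _ isT).
apply: filterS => n /=; set C := [set t | _]; rewrite ler_pdivlMr // => qn.
apply: (@le_trans _ _ (iter n op (fun t => (fk w k y + n%:R * (al / 2)) + (- (n%:R * c)) * chi R C t) y)).
  rewrite iter_kopD iter_kopZ (iter_kop_cst stochA) //.
  rewrite -addrA lerD2l mulNr -mulrA -mulrBr; apply: ler_wpM2l => //.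
  by rewrite [c * _]mulrC; move: qn; rewrite -/al; lra.
apply: (iter_local stochA) => // t St yt.
have := fk_lip w k yt; rewrite ler_norml => /andP[lo _].
rewrite /chi; case: asboolP => [_|/negP].
  by rewrite mulr1 /c; have : 0 <= n%:R :> R by []; lra.
by rewrite -leNgt mulr0 -/al; lra.
Qed.

End Drift.

(** * Growth near a face *)

Section Main.
Context (R : realType) (d : nat) (s : {set 'I_d} -> nat).
Context (p : {set 'I_d} -> {set 'I_d} -> 'rV[int]_d -> nat -> nat -> R).
Context (L : process R (state d)).
Context (m : nat) (w : 'I_m.+1 -> 'rV[R]_d).
Hypothesis s_gt0 : forall A, (0 < s A)%N.
Hypothesis chain0 : is_mmrrw s p L.
Implicit Types (A : {set 'I_d}) (y t : state d).

Local Notation S := (expanded_space s).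
Local Notation op := (@opA R d s p).
Local Notation F := (F w).

Let stoch0 := stochA chain0.

Lemma nat_above (x : R) : exists n : nat, x <= n%:R.
Proof.
exists (Num.bound `|x|); apply: le_trans (ler_norm x) _.
by apply: ltW; apply: archi_boundP.
Qed.

Definition grows (M : nat) y : Prop :=
  exists n, (0 < n <= M)%N /\ F y + 1 <= iter n (op finset.set0) F y.

Lemma grows_le M M' y : (M <= M')%N -> grows M y -> grows M' y.
Proof.
move=> MM' [n [/andP[n0 nM] g]]; exists n; split => //.
by rewrite n0 (leq_trans nM).
Qed.

(* Since [f] is convex, it grows in the direction of the drift as soon as one
   linear piece that is active at [x] does; projecting [x] onto the face gives a
   point of [V_ K A], at which the active piece is in [I_f]. *)
Lemma stable_face (Lhat : {set 'I_d} -> process R (state d))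
    (a : {set 'I_d} -> 'rV[R]_d) (K u : {set 'I_d} -> nat) (c : R) A M :
  is_expanded_chain s p A (Lhat A) ->
  is_mean_drift s Lhat A (a A) -> D_stable s Lhat A -> partition_params K u ->
  (forall A, D_f_stable s Lhat w K c A ->
     forall k, I_f s w K A k -> 0 < f_ w k (a A)) ->
  (0 < M)%N ->
  exists M' : nat, forall y, S finset.set0 y -> M'%:R < F y ->
    (forall l, l \in A -> M'%:Z <= y.1 ord0 l) -> near_face A M y -> grows M' y.
Proof.
move=> chA aA stA KP drift M0; have K1 := stochA chA.
pose T := ({ffun 'I_d -> 'I_M} * 'I_(max_phase s).+1 * 'I_m.+1)%type.
(* Passing from [y] to its projection [y1] and back costs [lip w * M] each way; the 1 is the gain to
   be shown. *)
pose g := 2 * (lip w * M%:R) + 1.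
(* Finitely many states modulo translation and finitely many pieces: one time serves them all. *)
have ev : \forall n \near \oo, forall i : T, S A (tstate A i.1) ->
    0 < f_ w i.2 (a A) ->
    fk w i.2 (tstate A i.1) + g <= iter n (op A) (fk w i.2) (tstate A i.1).
  apply: filter_forall => -[b k] /=.
  have [Sb|?] := pselect (S A (tstate A b)); last by apply: nearW.
  have [fa|?] := pselect (0 < f_ w k (a A)); last by apply: nearW.
  have [N HN] := nat_above (g / (f_ w k (a A) / 4)).
  near=> n => _ _; apply: le_trans (_ : fk w k (tstate A b) + n%:R * (f_ w k (a A) / 4) <= _).
    rewrite lerD2l -ler_pdivrMr ?divr_gt0 //; apply: le_trans HN _.
    by rewrite ler_nat; near: n; exact: nbhs_infty_ge.
  by near: n; exact: (mean_drift_growth chA aA fa Sb).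
case: ev => n0 _ ev; set n := n0.+1.
have {}ev := ev n (leqnSn n0).
have [N HN] := nat_above (c + lip w * M%:R).
(* [n.+1] keeps the coordinates in [A] positive for [n] steps, [K A] puts the projection into
   [V_ K A], and [N] keeps [F] above [c] there. *)
exists (n.+1 + K A + N)%N => y Sy Fy yA yM.
have c0 : c + lip w * M%:R < F y.
  apply: le_lt_trans HN (le_lt_trans _ Fy); rewrite ler_nat; exact: leq_addl.
have y0 l : 0 <= y.1 ord0 l by apply: Sy.1; rewrite inE.
pose y1 : state d := (erase (~: A) y.1, 1%N).
have y1y l : `|y1.1 ord0 l - y.1 ord0 l| <= M%:Z.
  rewrite mxE inE; case: (boolP (l \in A)) => lA /=; first by rewrite subrr normr0.
  by have := y0 l; have := yM l lA; lia.
have yy1 l : `|y.1 ord0 l - y1.1 ord0 l| <= M%:Z by rewrite distrC.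
have Sy1 : S finset.set0 y1.
  split => [l _|]; last by rewrite /= s_gt0.
  by rewrite mxE; case: ifP.
have cF1 : c < F y1 by have := F_lip w y1y; lra.
have Vy1 : V_ s K A y1.
  split => // [l lA|[C [AC HC]]].
    by rewrite mxE inE lA /=; have := yA l lA; lia.
  (* A larger set has an index outside [A], where the projection vanishes while [K C] is
     positive. *)
  have /subsetPn[l lC lA] : ~~ (C \subset A).
    by apply: contraL AC => /subset_leq_card; rewrite -leqNgt.
  have C0 : C != finset.set0 by apply/set0Pn; exists l.
  by have [KC _ _] := KP C C0; have := HC l lC; rewrite mxE inE lA /=; lia.
have [k Fk] := F_attained w y1.
have fa : 0 < f_ w k (a A).
  apply: drift; last by exists y1.
  exists A, finset.set0; rewrite finset.setU0; split => //; first by exists y1.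
  by split; [case: stA|exact: finset.sub0set|rewrite finset.setU0].
have SyA : S A y.
  by apply/expanded_pos => // l lA; have := yA l lA; lia.
have [b yb] := near_face_type M0 SyA yM.
have Stau : S A (tstate A b) by rewrite -yb; have /erase_expanded[] := SyA.
exists n; split; first by rewrite /n; lia.
apply: (@le_trans _ _ (iter n (op finset.set0) (fk w k) y)); last first.
  by apply: (iter_kop_le stoch0) => // t _; exact: fk_le_F.
rewrite (@iter_couple _ _ _ _ A); last by move=> l lA; have := yA l lA; lia.
rewrite [in leRHS](shift_erase A y) iter_shift; last exact: erase_diff.
rewrite yb.
(* By linearity, the translation changes [fk w k] by a constant. *)
apply: (@le_trans _ _ (iter n (op A)
   (fun t => fk w k t + (fk w k y - fk w k (tstate A b))) (tstate A b))); last first.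
  apply: (iter_kop_le K1) => // t _ /=; rewrite addrC -lerBrDr !fkB.
  apply: ler_sum => l _; rewrite -yb /=.
  suff -> : (t.1 + (y.1 - erase A y.1)) ord0 l - t.1 ord0 l =
    y.1 ord0 l - erase A y.1 ord0 l by [].
  by rewrite !mxE addrC addKr.
rewrite iter_kopD (iter_kop_cst K1) //.
have evb : fk w k (tstate A b) + g <= iter n (op A) (fk w k) (tstate A b).
  exact: ev (b, k) Stau fa.
have := fk_lip w k yy1; rewrite ler_norml => /andP[lo _].
have := F_lip w y1y; rewrite Fk => lo2.
have := F_lip w yy1 => lo3.
by move: evb lo lo2 lo3; rewrite /g; lra.
Unshelve. all: by end_near.
Qed.

Definition corner (M : nat) y : {set 'I_d} := [set l | M%:Z <= y.1 ord0 l]%SET.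

(** A single [M] serves as level of [F], as threshold for large coordinates and as bound on the
    number of steps. *)
Definition drifts (r : nat) : Prop :=
  exists M : nat, forall y, S finset.set0 y -> M%:R < F y ->
    (r <= #|corner M y|)%N -> grows M y.

(* While the process stays close to a face [A] with transient [L^A], it can be
   compared with the expanded chain, whose expected number of visits to the
   neighbourhood of the face is bounded; all other steps are taken in larger
   corners, where [f] grows. *)
Lemma transient_face (Lhat : {set 'I_d} -> process R (state d)) A M :
  is_expanded_chain s p A (Lhat A) -> induced_transient s Lhat A ->
  (0 < M)%N ->
  (forall y, S finset.set0 y -> M%:R < F y -> (#|A|.+1 <= #|corner M y|)%N ->
    grows M y) ->
  exists M' : nat, forall y, S finset.set0 y -> M'%:R < F y ->
    (forall l, l \in A -> M'%:Z <= y.1 ord0 l) -> near_face A M y -> grows M' y.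
Proof.
move=> chA trA M0 IH.
(* A growth of 1 within [M] steps is at least [e] per step. A step near the face loses at most
   [lip w]; [b] pays for this and for the missing [e]. *)
pose e : R := M%:R^-1; pose b := lip w + e; pose N := chi R (near_face A M).
have MR0 : 0 < M%:R :> R by rewrite ltr0n.
have e0 : 0 < e by rewrite invr_gt0.
have eM : e * M%:R = 1 by rewrite mulVf // gt_eqF.
have lip0 := lip_ge0 w.
have b0 : 0 <= b by rewrite addr_ge0 // ltW.
have step y : S finset.set0 y -> M%:R < F y ->
    (forall l, l \in A -> M%:Z <= y.1 ord0 l) ->
    exists n, (0 < n <= M)%N /\
      F y + e * n%:R - b * N y <= iter n (op finset.set0) F y.
  move=> Sy Fy yA; have [yN|yN] := pselect (near_face A M y).
    exists 1%N; split; first by rewrite M0.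
    rewrite /N /chi asboolT //.
    have : iter 1 (op finset.set0) (fun=> F y - lip w * 1) y <= iter 1 (op finset.set0) F y.
      apply: (iter_local stoch0) => // t _ yt; exact: (F_lip w yt).
    rewrite (iter_kop_cst stoch0) //; apply: le_trans; rewrite /b /= !mulr1n; lra.
  have [n [/andP[n0 nM] g]] : grows M y.
    apply: IH => //; move/existsNP: yN => [l /not_implyP[lA /negP]].
    rewrite -leNgt => yl; apply: (@leq_trans #|l |: A|).
      by rewrite cardsU1 lA.
    apply/subset_leq_card/fintype.subsetP => i; rewrite !inE => /orP[/eqP -> //|].
    exact: yA.
  exists n; split; first by rewrite n0.
  rewrite /N /chi asboolF // mulr0n mulr0; apply: le_trans g.
  have : e * n%:R <= e * M%:R by rewrite ler_wpM2l ?(ltW e0) // ler_nat.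
  by lra.
(* The blocks given by [step] are chained by strong induction on [k]; [b * M] pays for a last
   stretch shorter than [M], which may be too short for a block. *)
have main k : forall y, S finset.set0 y -> M%:R + lip w * k%:R < F y ->
    (forall l, l \in A -> (M + k)%:Z <= y.1 ord0 l) ->
    F y + e * k%:R - b * \sum_(i < k) iter i (op finset.set0) N y - b * M%:R <=
    iter k (op finset.set0) F y.
  elim/ltn_ind: k => k IHk y Sy Fy yA.
  have N0 i t : S finset.set0 t -> 0 <= iter i (op finset.set0) N t.
    move=> St; rewrite -[leLHS](iter_kop_cst stoch0 i 0 St).
    by apply: (iter_kop_le stoch0) => // t' _; exact: chi_ge0.
  have [kM|Mk] := ltnP k M.
    have : iter k (op finset.set0) (fun=> F y - lip w * k%:R) y <= iter k (op finset.set0) F y.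
      apply: (iter_local stoch0) => // t _ yt; exact: (F_lip w yt).
    rewrite (iter_kop_cst stoch0) //; apply: le_trans.
    have : 0 <= b * \sum_(i < k) iter i (op finset.set0) N y.
      by rewrite mulr_ge0 //; apply: sumr_ge0 => i _; exact: N0.
    have : b * k%:R <= b * M%:R by rewrite ler_wpM2l // ler_nat ltnW.
    by rewrite {1}/b; lra.
  have lk0 : 0 <= lip w * k%:R by rewrite mulr_ge0.
  have [n [/andP[n0 nM] g]] : exists n, (0 < n <= M)%N /\
      F y + e * n%:R - b * N y <= iter n (op finset.set0) F y.
    by apply: step => // [|l lA]; [lra|have := yA l lA; lia].
  have nk : (n <= k)%N by exact: leq_trans Mk.
  pose G t := \sum_(i < k - n) iter i (op finset.set0) N t.
  have le1 : iter n (op finset.set0)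
      (fun t => (F t + (e * (k - n)%:R - b * M%:R)) + (- b) * G t) y <=
      iter k (op finset.set0) F y.
    rewrite -{2}(subnKC nk) iterD; apply: (iter_local stoch0) => // t St yt.
    have := IHk (k - n)%N _ t St; rewrite ltn_subrL n0 (leq_trans n0 nk) => /(_ isT).
    have -> : F t + (e * (k - n)%:R - b * M%:R) + - b * G t =
      F t + e * (k - n)%:R - b * G t - b * M%:R by ring.
    apply.
      have := F_lip w yt; rewrite natrB // mulrBr; lra.
    by move=> l lA; have := yA l lA; have := yt l; lia.
  apply: le_trans le1; rewrite iter_kopD iter_kopD iter_kopZ (iter_kop_cst stoch0) //.
  rewrite /G iter_kop_sum.
  have -> : \sum_(i < k) iter i (op finset.set0) N y =
      \sum_(i < n) iter i (op finset.set0) N y +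
      \sum_(i < k - n) iter n (op finset.set0) (iter i (op finset.set0) N) y.
    rewrite -[in LHS](subnKC nk) big_split_ord /=; congr (_ + _).
    by apply: eq_bigr => i _; rewrite iterD.
  have : b * N y <= b * \sum_(i < n) iter i (op finset.set0) N y.
    rewrite ler_wpM2l //; case: n n0 {g nM nk G} => // n _.
    by rewrite big_ord_recl /= lerDl; apply: sumr_ge0 => i _; exact: (N0 i.+1).
  have : e * k%:R = e * n%:R + e * (k - n)%:R by rewrite -mulrDr -natrD subnKC.
  by rewrite mulrDr; lra.
have [G GP] := visits_near_face chA trA M0.
(* For this [k] the gain over [k.+1] steps exceeds the bounded total cost by at least 1. *)
have [k Hk] := nat_above ((b * G + b * M%:R + 1) / e).
have [B HB] := nat_above (M%:R + lip w * k.+1%:R).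
exists (M + k.+2 + B)%N => y Sy Fy yA yN; exists k.+1; split; first by lia.
have yk l : l \in A -> (k.+1)%:Z < y.1 ord0 l by move=> lA; have := yA l lA; lia.
have SyA : S A y by apply/expanded_pos => // l lA; have := yA l lA; lia.
have := main k.+1 y Sy; have -> : \sum_(i < k.+1) iter i (op finset.set0) N y =
    \sum_(i < k.+1) iter i (op A) N y.
  apply: eq_bigr => i _; apply: iter_couple => l lA.
  by have := yk l lA; have := ltn_ord i; lia.
move=> Hk1; apply: le_trans (Hk1 _ _).
- have := ler_wpM2l b0 (GP k.+1 y SyA).
  have : b * G + b * M%:R + 1 <= e * k.+1%:R.
    by rewrite [e * _]mulrC -ler_pdivrMr //; apply: le_trans Hk _; rewrite ler_nat.
  by rewrite -/N; lra.
- by apply: le_lt_trans HB (le_lt_trans _ Fy); rewrite ler_nat; lia.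
- by move=> l lA; have := yA l lA; lia.
Qed.

End Main.

(** * Escape to infinity *)

Section Escape.
Context (R : realType) (d : nat) (s : {set 'I_d} -> nat).
Context (p : {set 'I_d} -> {set 'I_d} -> 'rV[int]_d -> nat -> nat -> R).
Context (L : process R (state d)).
Context (m : nat) (w : 'I_m.+1 -> 'rV[R]_d).
Hypothesis chain0 : is_mmrrw s p L.
Implicit Types (A : {set 'I_d}) (y t : state d).

Local Notation S := (expanded_space s).
Local Notation op := (@opA R d s p finset.set0).
Local Notation F := (F w).
Local Notation grows := (grows s p w).
Local Notation drifts := (drifts s p w).
Local Notation hit0 := (hit (S finset.set0) (expanded_trans p finset.set0) (@mstep d s)).

Let stoch0 := stochA chain0.

Lemma corner_le M M' y : (M <= M')%N -> corner M' y \subset corner M y.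
Proof.
by move=> MM'; apply/fintype.subsetP => l; rewrite !inE; lia.
Qed.

(** The shape shared by [stable_face] and [transient_face], so that the descent need not distinguish
    them. *)
Hypothesis face_growth : forall A M, A != finset.set0 -> (0 < M)%N ->
  (forall y, S finset.set0 y -> M%:R < F y -> (#|A|.+1 <= #|corner M y|)%N ->
    grows M y) ->
  exists M' : nat, forall y, S finset.set0 y -> M'%:R < F y ->
    (forall l, l \in A -> M'%:Z <= y.1 ord0 l) -> near_face A M y -> grows M' y.

(** Either more than [r] coordinates reach [M], the known case, or those reaching [M] are exactly
    those reaching the larger [M1]. Then they form a face of size [r] with all other coordinates
    below [M], and [face_growth] applies. *)
Lemma drifts_pred r : (0 < r)%N -> drifts r.+1 -> drifts r.
Proof.
move=> r0 [M0 HM0]; pose M := M0.+1.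
have HM y : S finset.set0 y -> M%:R < F y -> (r.+1 <= #|corner M y|)%N -> grows M y.
  move=> Sy Fy ry; apply: (grows_le (leqnSn M0)); apply: HM0 => //.
    by apply: le_lt_trans Fy; rewrite ler_nat.
  by apply: leq_trans ry (subset_leq_card _); exact: corner_le.
have /choice[f Hf] : forall A, exists M' : nat, #|A| = r ->
    forall y, S finset.set0 y -> M'%:R < F y ->
    (forall l, l \in A -> M'%:Z <= y.1 ord0 l) -> near_face A M y -> grows M' y.
  move=> A; have [Ar|nAr] := eqVneq #|A| r; last by exists 0%N => /eqP; rewrite (negbTE nAr).
  have A0 : A != finset.set0 by rewrite -card_gt0 Ar.
  have [||M' HM'] := face_growth (M := M) A0 => //; first by rewrite Ar.
  by exists M'.
pose M1 := (M + \max_A f A)%N.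
have MM1 : (M <= M1)%N by exact: leq_addr.
exists M1 => y Sy Fy ry.
have FM1 k : (k <= M1)%N -> k%:R < F y.
  by move=> kM1; apply: le_lt_trans Fy; rewrite ler_nat.
have [rM|Mr] := ltnP r #|corner M y|.
  by apply: (grows_le MM1); apply: HM => //; exact: FM1.
have sub := corner_le y MM1.
have E : corner M1 y = corner M y.
  by apply/eqP; rewrite eqEcard sub (leq_trans Mr).
pose A := corner M1 y.
have Ar : #|A| = r by apply/eqP; rewrite eqn_leq ry andbT /A E.
have fM1 : (f A <= M1)%N.
  exact: leq_trans (leq_bigmax (F := f) A) (leq_addl _ _).
apply: (grows_le fM1); apply: Hf => //; first exact: FM1.
  by move=> l; rewrite inE; move: fM1; lia.
by move=> l; rewrite /A E inE; lia.
Qed.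

(** The descent starts at [d.+1], where the claim is vacuous, and ends at 1. An empty corner leaves
    only bounded states, with [F] at most [lip w * M]. *)
Lemma drifts0 : drifts 0.
Proof.
have drifts1 : drifts 1.
  suff H k : drifts (d.+1 - k)%N \/ (d.+1 - k = 0)%N.
    have := H d; rewrite subSn // subnn => -[//|//].
  elim: k => [|k IHk].
    left; rewrite subn0; exists 0%N => y _ _ /leq_trans/(_ (max_card _)).
    by rewrite card_ord ltnn.
  case E : (d.+1 - k.+1)%N => [|r]; first by right.
  left; rewrite -E; apply: drifts_pred; first by rewrite E.
  by case: IHk; rewrite (_ : (d.+1 - k)%N = (d.+1 - k.+1).+1) //; lia.
case: drifts1 => M HM; have [N HN] := nat_above (lip w * M%:R).
exists (M + N)%N => y Sy Fy _; apply: (@grows_le _ _ _ _ _ _ M); first exact: leq_addr.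
apply: HM => //; first by apply: le_lt_trans Fy; rewrite ler_nat leq_addr.
rewrite lt0n; apply/negP => /eqP/cards0_eq yM.
have yl l : `|y.1 ord0 l - (0 : 'rV[int]_d) ord0 l| <= M%:Z.
  move/setP/(_ l): yM; rewrite !inE mxE subr0 => /negbT.
  by have := Sy.1 l; rewrite inE => /(_ isT); lia.
have yl' l : `|(0 : 'rV[int]_d) ord0 l - y.1 ord0 l| <= M%:Z by rewrite distrC.
have := @F_lip _ _ _ w y (0, 0%N) M yl'.
have -> : F (0, 0%N) = 0.
  by have := F_scale w 0 (0 : 'rV[int]_d) 0%N; rewrite mulr0n mul0r.
have : N%:R <= (M + N)%:R :> R by rewrite ler_nat leq_addl.
by lra.
Qed.

(** From [1 + x <= expR x]: the right-hand side times [1 + x] is [1 + x ^+ 2 * (1 + 2 * x)]. *)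
Lemma expR_neg_le (x : R) : `|x| <= 1 / 2 -> expR (- x) <= 1 - x + 2 * x ^+ 2.
Proof.
rewrite ler_norml => /andP[lo hi]; rewrite expRN.
have x1 : 0 < 1 + x by lra.
apply: (@le_trans _ _ (1 + x)^-1).
  by rewrite lef_pV2 ?posrE ?expR_gt0 //; exact: expR_ge1Dx.
rewrite -div1r ler_pdivrMr //.
have : 0 <= x ^+ 2 * (1 + 2 * x) by rewrite mulr_ge0 ?sqr_ge0 //; lra.
by rewrite !mulrDr !mulrDl; rewrite expr2; lra.
Qed.

(** [C] is out of reach during the first [i] steps, so only what follows them counts. *)
Lemma hit_skip C i n y : S finset.set0 y ->
  (forall t, S finset.set0 t ->
    (forall l, `|t.1 ord0 l - y.1 ord0 l| <= i%:Z) -> ~ C t) ->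
  hit0 C (i + n) y = iter i op (hit0 C n) y.
Proof.
elim: i y => [//|i IHi] y Sy notC; rewrite addSn /= asboolF; last first.
  by apply: notC => // l; rewrite subrr normr0.
apply: kop_eq => u Su; apply: IHi => // t St tu; apply: notC => // l.
by have := tu l; have := mstep_dist y u l; lia.
Qed.

(* [exp (- th * f)] is a supermartingale along the times given by [grows]. *)
Lemma escape (b : R) : exists B : R, forall y, S finset.set0 y -> B < F y ->
  forall n, hit0 [set t | F t <= b] n y <= 1 / 2.
Proof.
have [M HM] := drifts0; set H := [set t | _].
have lip0 := lip_ge0 w.
pose c : R := lip w * M%:R + 1.
have c1 : 1 <= c by rewrite lerDr mulr_ge0.
(* Within [M] steps [F] changes by at most [c], so this [th] makes the second-order term
   [2 * (th * D) ^+ 2] at most [th], which the mean gain of 1 compensates. *)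
pose th : R := (2 * c ^+ 2)^-1.
have c2 : 0 < 2 * c ^+ 2 by rewrite mulr_gt0 // exprn_gt0 // (lt_le_trans ltr01).
have th0 : 0 < th by rewrite invr_gt0.
have thc : th * c ^+ 2 = 1 / 2.
  by rewrite /th invfM -mulrA mulVf ?mulr1 ?div1r // expf_neq0 // gt_eqF // (lt_le_trans ltr01).
have thc1 : th * c <= 1 / 2.
  by rewrite -thc expr2 mulrA ler_peMr // mulr_ge0 ?(ltW th0) // (le_trans ler01).
(* Above [c3], [grows] is available and [F] stays above [b] for [M] steps; below it, the exponential
   bound is at least 1. *)
pose c3 : R := Num.max M%:R b + c.
have super n y : S finset.set0 y -> (n <= M)%N ->
    F y + 1 <= iter n op F y ->
    iter n op (fun t => expR (th * (c3 - F t))) y <= expR (th * (c3 - F y)).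
  move=> Sy nM g; set e := expR (th * (c3 - F y)).
  have e0 : 0 < e by exact: expR_gt0.
  have -> : e = e * (1 + th) + (- (e * th)) * 1 by ring.
  apply: (@le_trans _ _ (iter n op (fun t => e * (1 + th) + (- (e * th)) * (F t - F y)) y)); last first.
    rewrite iter_kopD (iter_kop_cst stoch0) // iter_kopZ iter_kopB (iter_kop_cst stoch0) //.
    rewrite lerD2l !mulNr lerN2.
    by apply: ler_wpM2l; [rewrite mulr_ge0 ?ltW|rewrite lerBrDl; exact: g].
  apply: (iter_local stoch0) => // t St yt.
  have lo := F_lip w yt.
  have hi : F t - lip w * n%:R <= F y by apply: F_lip => l; rewrite distrC.
  have ln : lip w * n%:R <= c.
    by apply: (@le_trans _ _ (lip w * M%:R)); rewrite ?ler_wpM2l ?ler_nat // lerDl.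
  pose D := F t - F y.
  have Dc : `|D| <= c by rewrite ler_norml /D; lra.
  have -> : expR (th * (c3 - F t)) = e * expR (- (th * D)).
    by rewrite /e -expRD; congr expR; rewrite /D; ring.
  have -> : e * (1 + th) + - (e * th) * (F t - F y) = e * (1 - th * D + th).
    by rewrite /D; ring.
  rewrite ler_pM2l //; apply: le_trans (expR_neg_le _) _.
    rewrite normrM (gtr0_norm th0); apply: le_trans thc1.
    by rewrite ler_wpM2l // ltW.
  rewrite lerD2l exprMn.
  have D2 : D ^+ 2 <= c ^+ 2 by rewrite -real_normK ?num_real // lerXn2r ?nnegrE // (le_trans ler01).
  have : th * (th * D ^+ 2) <= th * (th * c ^+ 2) by rewrite !ler_wpM2l // ltW.
  by rewrite thc expr2; lra.
have main n : forall y, S finset.set0 y -> hit0 H n y <= expR (th * (c3 - F y)).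
  elim/ltn_ind: n => n IHn y Sy.
  have [yc3|c3y] := leP (F y) c3.
    apply: le_trans (hit_le1 stoch0 H n Sy) _.
    apply: le_trans (expR_ge1Dx _); rewrite lerDl mulr_ge0 ?(ltW th0) //; lra.
  have Mc3 : M%:R <= c3 - c by rewrite /c3 addrK le_max lexx.
  have bc3 : b <= c3 - c by rewrite /c3 addrK le_max lexx orbT.
  case: n IHn => [|n] IHn.
    by rewrite /= asboolF ?expR_ge0 // /H /=; apply/negP; rewrite -ltNge; lra.
  have [i [/andP[i0 iM] g]] : grows M y by apply: HM => //; lra.
  (* As [i] may exceed [n.+1], the horizon is first extended; the part left after [i > 0] steps is
     shorter than [n.+1]. *)
  apply: le_trans (hit_mono stoch0 H Sy (_ : n.+1 <= i + (n.+1 - i))%N) _; first by lia.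
  rewrite hit_skip // => [|t St yt].
    apply: le_trans (super i y Sy iM g).
    by apply: (iter_kop_le stoch0) => // t St; apply: IHn => //; lia.
  rewrite /H /=; apply/negP; rewrite -ltNge.
  have := F_lip w yt.
  have : lip w * i%:R <= lip w * M%:R by rewrite ler_wpM2l // ler_nat.
  by move: bc3; rewrite /c; lra.
exists (c3 + th^-1) => y Sy Fy n; apply: le_trans (main n y Sy) _.
apply: (@le_trans _ _ (expR (- 1))).
  rewrite ler_expR; have : th * (th^-1) = 1 by rewrite mulfV // gt_eqF.
  have : th * (th^-1) <= th * (F y - c3) by rewrite ler_wpM2l ?(ltW th0) //; lra.
  by rewrite !mulrBr; lra.
rewrite expRN div1r lef_pV2 ?posrE ?expR_gt0 //.
by apply: le_trans (expR_ge1Dx 1); lra.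
Qed.

End Escape.

(** * Instability *)

(* If the far state [y], reachable from [z], misses [z] with probability at
   least 1/2, then so does, up to a constant, a path returning from [z]: with
   [q] the return probability, [hit {z}] loses at most [1 - q] per step under
   the kernel, and it starts from the value 1 at [z]. *)
Lemma return_lt1 (R : realType) (T : countType) (U : finType) (S : set T)
    (P : T -> T -> R) (step : T -> U -> T) (z y : T) (n0 : nat) :
  stochastic S P step -> S z -> S y ->
  0 < iter n0 (kop S P step) (chi R [set y]) z ->
  (forall n, hit S P step [set z] n y <= 1 / 2) ->
  exists2 b : R, b < 1 & forall n, kop S P step (hit S P step [set z] n) z <= b.
Proof.
move=> K Sz Sy; set be := iter _ _ _ _ => be0 hy.
have n10 : 0 < n0.+1%:R :> R by rewrite ltr0n.
(* A loss of at least [be / 2] is spread over [n0] steps, each losing at most [1 - q]; [n0.+1] keeps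
   the divisor positive. *)
exists (1 - be / 2 / n0.+1%:R) => [|n]; first by rewrite gtrDl oppr_lt0 !divr_gt0.
set phi := hit _ _ _ _ n; set q := kop _ _ _ phi z.
have q1 : q <= 1.
  by rewrite -[leRHS](kop_cst K 1 Sz); apply: (kop_le K) => // u; exact: hit_le1.
have lossy t : S t -> phi t - (1 - q) <= kop S P step phi t.
  move=> St; have [->|tz] := pselect (t = z).
    by rewrite /phi hit_in // opprB addrC addrNK.
  apply: (@le_trans _ _ (hit S P step [set z] n.+1 t)); last by rewrite /= asboolF.
  by apply: le_trans (hit_leS K _ n St); rewrite lerBlDr lerDl subr_ge0.
have iter_lossy i t : S t -> phi t - i%:R * (1 - q) <= iter i (kop S P step) phi t.
  elim: i t => [|i IHi] t St /=; first by rewrite mul0r subr0.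
  apply: (@le_trans _ _ (kop S P step (fun t => phi t - i%:R * (1 - q)) t)); last first.
    by apply: (kop_le K) => // u; exact: IHi.
  rewrite kopB (kop_cst K) // -natr1 mulrDl mul1r opprD addrA addrAC lerD2r.
  exact: lossy.
have up : iter n0 (kop S P step) phi z <= 1 - be / 2.
  apply: (@le_trans _ _ (iter n0 (kop S P step) (fun t => 1 + (- (1 / 2)) * chi R [set y] t) z)).
    apply: (iter_kop_le K) => // t St; rewrite /chi; case: asboolP => [->|_] /=.
      by rewrite mulr1n mulr1; apply: le_trans (hy n) _; lra.
    by rewrite mulr0n mulr0 addr0; exact: hit_le1.
  by rewrite iter_kopD (iter_kop_cst K) // iter_kopZ -/be; lra.
have := le_trans (iter_lossy n0 z Sz) up; rewrite /phi hit_in // => le1.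
have le2 : be / 2 <= n0.+1%:R * (1 - q) by rewrite -[n0.+1%:R]natr1 mulrDl; lra.
have : be / 2 / n0.+1%:R <= 1 - q by rewrite ler_pdivrMr // [_ * n0.+1%:R]mulrC.
by rewrite !lerBrDr addrC.
Qed.

Theorem theorem3p2 (R : realType) (d : nat)
  (s : {set 'I_d} -> nat)
  (p : {set 'I_d} -> {set 'I_d} -> 'rV[int]_d -> nat -> nat -> R)
  (L : process R (state d)) (Lhat : {set 'I_d} -> process R (state d))
  (S0 : set (state d))
  (a : {set 'I_d} -> 'rV[R]_d)
  (K u : {set 'I_d} -> nat)
  (m : nat) (w : 'I_m.+1 -> 'rV[R]_d) (c : R)
  (s_gt0 : forall A, (0 < s A)%N)
  (L_mmrrw : is_mmrrw s p L)
  (Lhat_expanded : forall A : {set 'I_d}, A != finset.set0 ->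
     is_expanded_chain s p A (Lhat A))
  (L_semi_irreducible : semi_irreducible (mmrrw_space s) L S0)
  (induced_dichotomy : forall A : {set 'I_d}, A != finset.set0 ->
     induced_stable s Lhat A \/ induced_transient s Lhat A)
  (a_drift : forall A : {set 'I_d}, D_stable s Lhat A ->
     is_mean_drift s Lhat A (a A))
  (Ku_params : partition_params K u)
  (c_gt0 : 0 < c)
  (A_f_neq0 : A_f s w c !=set0)
  (A_fC_S0_neq0 : A_fC s w c `&` S0 !=set0)
  (drift_gt0 : forall A : {set 'I_d}, D_f_stable s Lhat w K c A ->
     forall k : 'I_m.+1, I_f s w K A k -> 0 < f_ w k (a A)) :
  unstable (mmrrw_space s) L S0.
Proof.
have Km : is_expanded_chain s p finset.set0 L := L_mmrrw.
have st0 := stochA Km.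
have inj := @mstep_inj d s; have supp := @mstep_supp R d s p finset.set0.
have faces A M : A != finset.set0 -> (0 < M)%N ->
    (forall y, expanded_space s finset.set0 y -> M%:R < F w y ->
      (#|A|.+1 <= #|corner M y|)%N -> grows s p w M y) ->
    exists M' : nat, forall y, expanded_space s finset.set0 y -> M'%:R < F w y ->
      (forall l, l \in A -> M'%:Z <= y.1 ord0 l) -> near_face A M y ->
      grows s p w M' y.
  move=> A0 M0 IH; have [stA|trA] := induced_dichotomy A A0.
    have DA : D_stable s Lhat A by [].
    by have := stable_face s_gt0 Km (Lhat_expanded A A0) (a_drift A DA) DA Ku_params drift_gt0 M0.
  exact (transient_face Km (Lhat_expanded A A0) trA M0 IH).
have esc := escape Km faces.
have [[C0 [z0 Cz0] _ _] _ acc] := L_semi_irreducible.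
have [[b0 bS0]|unb] := pselect (exists b, forall t, S0 t -> F w t <= b).
  right; have [B HB] := esc b0.
  have [[x j] [Sx fx]] := A_f_neq0.
  have [n Hn] := nat_above (Num.max B b0 / c).
  (* [F] is homogeneous, so multiples of a point with [f > c > 0] pass every level; phase 1 exists
     on every face and does not affect [F]. *)
  pose y : state d := (x *+ n.+1, 1%N).
  have Sy : expanded_space s finset.set0 y.
    split => [l _|]; last by rewrite /= s_gt0.
    by rewrite /= mulmxnE mulrn_wge0 //; apply: Sx.1; rewrite inE.
  have Fy : Num.max B b0 < F w y.
    rewrite /y (F_scale w n.+1 x 1%N); rewrite ler_pdivrMr // in Hn.
    apply: le_lt_trans Hn _.
    apply: (@lt_trans _ _ (n.+1%:R * c)); first by rewrite ltr_pM2r // ltr_nat.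
    by rewrite ltr_pM2l ?ltr0n.
  move: Fy; rewrite gt_max => /andP[By b0y].
  exists y; split => //; first by move=> /bS0; rewrite leNgt b0y.
  apply: (never_hit_gt0 Km inj supp (b := 1 / 2) Sy); first by lra.
  move=> n'; apply: le_trans (HB y Sy By n').
  exact: (hit_subset st0).
left => z S0z; have Sz := C0 z S0z.
(* The level set at [F w z] contains [z], so missing the level set implies missing [z]. *)
have [B HB] := esc (F w z).
have [y S0y By] : exists2 y, S0 y & B < F w y.
  apply: contrapT => nB; apply: unb; exists B => t S0t; rewrite leNgt.
  by apply/negP => Bt; apply: nB; exists t.
have Sy := C0 y S0y.
have [n0] := acc z y Sz S0y.
rewrite [X in (_ < X)%E](law_traj Km inj supp n0 [set y] Sz) lte_fin => be0.
have [|b b1 hb] := return_lt1 st0 Sz Sy be0.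
  move=> n; apply: le_trans (HB y Sy By n); apply: (hit_subset st0) => //.
  by move=> t ->; rewrite /=.
rewrite /transient; apply: le_lt_trans (passage_le Km inj supp (C := [set z]) Sz hb) _.
by rewrite lte_fin.
Qed.
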